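(* Let $(M,\widetilde B)$ be a strict root of unity quantum seed with respect to a skew-symmetric integer matrix $\Lambda\in M_N(\mathbb Z)$, let $(M_q,\widetilde B)$ be the associated quantum seed and $\kappa_\varepsilon:\mathcal T_q(M_q)\to\mathcal T_\varepsilon(M)$ the associated specialization map, and let $\mathrm{inv}\subseteq[1,N]\setminus\mathrm{ex}$. Then there is an isomorphism of $\mathbb Z[\varepsilon^{1/2}]$-algebras $$\kappa_\varepsilon\big(\mathcal A_q(M_q,\widetilde B,\mathrm{inv})\big)\cong\mathcal A_\varepsilon(M,\widetilde B,\mathrm{inv}).$$
   Context: Root of unity setting: $\ell$ a positive integer, $\mathbb Z_\ell=\mathbb Z/\ell\mathbb Z$, $\varepsilon^{1/2}\in\mathbb C$ a primitive $\ell$-th root of unity, $\mathcal A^{1/2}_\varepsilon=\mathbb Z[\varepsilon^{1/2}]$, $\varepsilon^{a/2}=(\varepsilon^{1/2})^a$; $\overline C$ = reduction mod $\ell$; $e_1,\dots,e_N$ standard basis. For skew-symmetric $\Lambda:\mathbb Z^N\times\mathbb Z^N\to\mathbb Z_\ell$, $\mathcal T_\varepsilon(\Lambda)$ has $\mathcal A^{1/2}_\varepsilon$-basis $X^f$ ($f\in\mathbb Z^N$) with $X^fX^g=\varepsilon^{\Lambda(f,g)/2}X^{f+g}$; a root of unity toric frame of a division algebra $\mathcal F$ over $\mathbb Q(\varepsilon^{1/2})$ is $M:\mathbb Z^N\to\mathcal F$ with $f\mapsto M(f)$ extending to an injective algebra map from some (unique) $\mathcal T_\varepsilon(\Lambda_M)$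 whose image generates $\mathcal F$ as a skew field; $\mathcal T_\varepsilon(M)$ is that image. Fix $\mathrm{ex}\subseteq[1,N]$; $\widetilde B=(b_{ij})$ integer, rows $[1,N]$, columns $\mathrm{ex}$, principal part $B$, columns $b^k$. $\ell$-compatibility w.r.t. $D=\mathrm{diag}(d_j)_{j\in\mathrm{ex}}$ ($d_j>0$): $DB$ skew-symmetric and $\sum_k\overline b_{kj}(\Lambda_M)_{ki}=\delta_{ij}\overline d_j$ mod $\ell$; seeds $(M,\widetilde B)$ are pairs with this property; mutation: $\mu_k(\widetilde B)$ has entries $-b_{ij}$ if $i=k$ or $j=k$ and $b_{ij}+(|b_{ik}|b_{kj}+b_{ik}|b_{kj}|)/2$ otherwise; $\mu_k(M)$ is the frame with matrix $\overline E^\top\Lambda_M\overline E$ ($e_{ij}=\delta_{ij}$ for $j\ne k$, $e_{kk}=-1$, $e_{ik}=\max(0,-b_{ik})$) with $\mu_k(M)(e_j)=M(e_j)$ for $j\ne k$ and $\mu_k(M)(e_k)=M(-e_k+[b^k]_+)+M(-e_k-[b^k]_-)$ ($[b]_\pm$ keeps entries with $\pm b_i\ge0$). $\mathcal A_\varepsilon(M,\widetilde B,\mathrm{inv})$ is the $\mathcal A^{1/2}_\varepsilon$-algebra generated by all cluster variables $M'(e_i)$ of mutation-equivalent seeds and $M(e_j)^{-1}$, $j\in\mathrm{inv}$. Quantum setting: $\mathcal A^{1/2}_q=\mathbb Z[q^{\pm1/2}]$; for skew-symmetric integer $\Lambda$, $\mathcal T_q(\Lambda)$ has $\mathcal A^{1/2}_q$-basis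 $X^f$ with $X^fX^g=q^{\Lambda(f,g)/2}X^{f+g}$; toric frames $M_q$ of division algebras over $\mathbb Q(q^{1/2})$ are defined analogously, $\Lambda_{M_q}\in M_N(\mathbb Z)$; $(\Lambda,\widetilde B)$ is compatible w.r.t. $D$ if $\sum_kb_{kj}\lambda_{ki}=\delta_{ij}d_j$; quantum seeds, their mutations (same formulas, with $E^\top\Lambda E$), and $\mathcal A_q(M_q,\widetilde B,\mathrm{inv})$ (the $\mathcal A^{1/2}_q$-algebra generated by cluster variables of mutation-equivalent quantum seeds and $M_q(e_j)^{-1}$, $j\in\mathrm{inv}$) are defined analogously; by the quantum Laurent phenomenon $\mathcal A_q(M_q,\widetilde B,\mathrm{inv})\subseteq\mathcal T_q(M_q)$. Strictness: $(M,\widetilde B)$ is strict w.r.t. $\Lambda\in M_N(\mathbb Z)$ skew-symmetric if $\overline\Lambda=\Lambda_M$ and $(\Lambda,\widetilde B)$ is compatible w.r.t. the same $D$. The associated quantum seed is $(M_q,\widetilde B)$ in $\mathcal F_q=\mathrm{Fract}(\mathcal T_q(\Lambda))$ with $M_q(f)=X^f$, $\Lambda_{M_q}=\Lambda$; the specialization map $\kappa_\varepsilon:\mathcal T_q(M_q)\to\mathcal T_\varepsilon(M)$ is the surjective ring homomorphism with $q^{1/2}\mapsto\varepsilon^{1/2}$ and $M_q(f)\mapsto M(f)$, whose kernel is generated by $\Phi_\ell(q^{1/2})$, $\Phi_\ell$ the $\ell$-th cyclotomic polynomial. *)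

(* Defs.v *)
From HB Require Import structures.
From mathcomp Require Import all_boot all_order all_algebra.
Set Implicit Arguments. Unset Strict Implicit. Unset Printing Implicit Defensive.
Import Order.TTheory GRing.Theory Num.Theory.
Local Open Scope ring_scope.

(* Exponent vectors f in Z^N are row vectors 'rV[int]_N; indices [1,N] are 'I_N.
   Integer N x N matrices are 'M[int]_N.  A Z_m-valued bilinear form is
   represented by an integer matrix whose entries are only meaningful mod m
   (m = 0 means: exact integer form, used for the quantum / generic case). *)

(* congruence of integers mod m (m = 0 : equality) *)
Definition congz (m : nat) (a b : int) : Prop := (a == b %[mod (m : int)])%Z.

Definition evec (N : nat) (j : 'I_N) : 'rV[int]_N := delta_mx 0 j.

Definition bform (N : nat) (L : 'M[int]_N) (f g : 'rV[int]_N) : int :=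
  (f *m L *m g^T) 0 0.

Definition skew_mod (N m : nat) (L : 'M[int]_N) : Prop :=
  forall i j, congz m (L i j) (- L j i).

Definition division_ring (F : unitRingType) : Prop :=
  forall x : F, x != 0 -> x \is a GRing.unit.

Definition central (F : unitRingType) (s : F) : Prop := forall x : F, s * x = x * s.

Definition char0 (F : unitRingType) : Prop := forall n : nat, (n.+1)%:R != (0 : F).

Definition transcendental (F : unitRingType) (s : F) : Prop :=
  forall p : {poly int}, p != 0 -> (map_poly (fun z : int => z%:~R : F) p).[s] != 0.

(* evaluation of a Laurent polynomial sum_i n_i s^{a_i}, given as a list of
   pairs (n_i, a_i), at the central scalar s *)
Definition lev (F : unitRingType) (s : F) (c : seq (int * int)) : F :=
  \sum_(p <- c) p.1%:~R * s ^ p.2.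

Definition skew_generates (F : unitRingType) (X : F -> Prop) : Prop :=
  forall S : F -> Prop,
    S 1 ->
    (forall x y, S x -> S y -> S (x - y)) ->
    (forall x y, S x -> S y -> S (x * y)) ->
    (forall x, S x -> x != 0 -> S x^-1) ->
    (forall x, X x -> S x) ->
    forall x, S x.

(* x lies in the Z[s^{±1}]-subalgebra of F generated by X
   (for s a root of unity, Z[s^{±1}] = Z[s]) *)
Definition alg_gen (F : unitRingType) (s : F) (X : F -> Prop) (x : F) : Prop :=
  forall S : F -> Prop,
    S 1 ->
    (forall x y, S x -> S y -> S (x - y)) ->
    (forall x y, S x -> S y -> S (x * y)) ->
    S s -> S s^-1 ->
    (forall y, X y -> S y) ->
    S x.

(* Toric frame M : Z^N -> F with matrix L (mod m), with respect to the central
   scalar s (s = eps^{1/2}, m = l, or s = q^{1/2}, m = 0):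
   f |-> M(f) extends to an injective algebra map from T_s(L) (basis X^f,
   X^f X^g = s^{L(f,g)} X^{f+g}) whose image generates F as a skew field. *)
Definition toric_frame (N : nat) (F : unitRingType) (m : nat) (s : F)
    (M : 'rV[int]_N -> F) (L : 'M[int]_N) : Prop :=
  [/\ skew_mod m L,
      M 0 = 1,
      (forall f g, M f * M g = s ^ bform L f g * M (f + g)),
      (* injectivity: the M(f) are linearly independent over Z[s^{±1}] *)
      (forall c : seq (seq (int * int) * 'rV[int]_N),
          uniq (map snd c) ->
          \sum_(p <- c) lev s p.1 * M p.2 = 0 ->
          forall p, p \in c -> lev s p.1 = 0)
    & skew_generates (fun x => x = s \/ exists f, x = M f)].

(* compatibility of (L, Btilde) w.r.t. D = diag(d_j)_{j in ex}, modulo m;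
   Btilde is stored as an N x N matrix of which only columns in ex are used *)
Definition compatible (N m : nat) (ex : {set 'I_N}) (d : 'I_N -> int)
    (L B : 'M[int]_N) : Prop :=
  [/\ forall j, j \in ex -> 0 < d j,
      forall i j, i \in ex -> j \in ex -> d i * B i j = - (d j * B j i)
    & forall i j, j \in ex ->
        congz m (\sum_k B k j * L k i) (if i == j then d j else 0)].

Definition mutB (N : nat) (k : 'I_N) (B : 'M[int]_N) : 'M[int]_N :=
  \matrix_(i, j) if (i == k) || (j == k) then - B i j
                 else B i j + ((`|B i k| * B k j + B i k * `|B k j|) %/ 2)%Z.

Definition mutE (N : nat) (k : 'I_N) (B : 'M[int]_N) : 'M[int]_N :=
  \matrix_(i, j) if j == k then (if i == k then -1 else Num.max 0 (- B i k))
                 else (if i == j then 1 else 0).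

Definition bpos (N : nat) (k : 'I_N) (B : 'M[int]_N) : 'rV[int]_N :=
  \row_i Num.max (B i k) 0.
Definition bneg (N : nat) (k : 'I_N) (B : 'M[int]_N) : 'rV[int]_N :=
  \row_i Num.min (B i k) 0.

Definition mut_frame (N : nat) (F : unitRingType) (m : nat) (s : F) (k : 'I_N)
    (B : 'M[int]_N) (M M' : 'rV[int]_N -> F) : Prop :=
  exists L L' : 'M[int]_N,
    [/\ toric_frame m s M L,
        toric_frame m s M' L',
        (forall i j, congz m (L' i j) (((mutE k B)^T *m L *m mutE k B) i j)),
        (forall j, j != k -> M' (evec j) = M (evec j))
      & M' (evec k) = M (- evec k + bpos k B) + M (- evec k - bneg k B)].

Inductive mut_equiv (N : nat) (F : unitRingType) (m : nat) (s : F)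
    (ex : {set 'I_N}) (M0 : 'rV[int]_N -> F) (B0 : 'M[int]_N) :
    ('rV[int]_N -> F) -> 'M[int]_N -> Prop :=
| mut_equiv_refl : mut_equiv m s ex M0 B0 M0 B0
| mut_equiv_step M B M' k :
    mut_equiv m s ex M0 B0 M B -> k \in ex -> mut_frame m s k B M M' ->
    mut_equiv m s ex M0 B0 M' (mutB k B).

Definition cluster_alg (N : nat) (F : unitRingType) (m : nat) (s : F)
    (ex : {set 'I_N}) (M : 'rV[int]_N -> F) (B : 'M[int]_N) (inv : {set 'I_N})
    : F -> Prop :=
  alg_gen s (fun x =>
    (exists M' B' i, mut_equiv m s ex M B M' B' /\ x = M' (evec i)) \/
    (exists j, j \in inv /\ x = (M (evec j))^-1)).

(* graph of the specialization map kappa : T_q(Mq) -> T_eps(M),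
   sum n_i q^{a_i/2} Mq(f_i) |-> sum n_i eps^{a_i/2} M(f_i) *)
Definition spec_rel (N : nat) (Fq F : unitRingType) (t : Fq) (Mq : 'rV[int]_N -> Fq)
    (e : F) (M : 'rV[int]_N -> F) (x : Fq) (y : F) : Prop :=
  exists c : seq (int * int * 'rV[int]_N),
    x = \sum_(p <- c) p.1.1%:~R * t ^ p.1.2 * Mq p.2 /\
    y = \sum_(p <- c) p.1.1%:~R * e ^ p.1.2 * M p.2.

Definition spec_image (N : nat) (Fq F : unitRingType) (t : Fq) (Mq : 'rV[int]_N -> Fq)
    (e : F) (M : 'rV[int]_N -> F) (A : Fq -> Prop) : F -> Prop :=
  fun y => exists2 x, A x & spec_rel t Mq e M x y.

Definition alg_iso (F : unitRingType) (s : F) (A B : F -> Prop) (phi : F -> F) : Prop :=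
  [/\ (forall x, A x -> B (phi x)),
      (forall x y, A x -> A y -> phi x = phi y -> x = y),
      (forall y, B y -> exists2 x, A x & phi x = y),
      phi 1 = 1
    & [/\ forall x y, A x -> A y -> phi (x + y) = phi x + phi y,
          forall x y, A x -> A y -> phi (x * y) = phi x * phi y
        & forall x, A x -> phi (s * x) = s * phi x]].

(* Main.v *)
(** The isomorphism is the identity: the two subalgebras of F coincide.  Both
    mutation classes are indexed by the same sequences of mutations, and kappa
    sends each quantum cluster variable to the corresponding one over eps,
    because kappa(x_k') kappa(x_k) is the image of the exchange polynomial and
    kappa(x_k) can be cancelled in F.  For this kappa must be defined on
    cluster variables, which is the quantum Laurent phenomenon.  It follows from
    the invariance of the Berenstein-Zelevinsky upper bound under mutation: if x
    is Laurent in the seeds M, M' = mu_i(M) and mu_j(M), then x is Laurent in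
    M'' = mu_j(M').  Indeed D x is Laurent in M'' for some product D of factors
    1 + c M'(w), where w = b^i or - b^i.  In the grading of M' by Lambda'(e_i, .)
    the exchange relation in direction j is homogeneous while M'(w) has nonzero
    degree, so these factors can be cancelled one by one. *)
Require Import Defs.
From HB Require Import structures.
From mathcomp Require Import all_boot all_order all_algebra.
From mathcomp Require Import zify ring.
Import Order.TTheory GRing.Theory Num.Theory.
Local Open Scope ring_scope.

(** * Exponent lattices and the tropical part of mutation *)

(** Over the root of unity the matrix of a frame is known only mod l, which gives no grading by
    integers. The integer lift supplied by strictness is therefore kept and mutated along with both
    seeds, and one theory of frames with an exact integer form serves both scalars. Compatibility,
    L(b^k, g) = d_k g_k with d_k a nonzero integer, drives every cancellation: it keeps the two
    exchange monomials distinct, makes them commute alike with monomials free of e_k, and gives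
    gradings in which b^j has degree 0 and b^i does not. Of the invariance of upper bounds only one
    inclusion is proved, from the mutated seed to the original one; it is iterated from the seed of
    a cluster variable back to the initial seed. *)

Section Bilinear.
Context {N : nat}.
Implicit Types (L B : 'M[int]_N) (f g h u v : 'rV[int]_N) (i j k : 'I_N).

Lemma bformDl L f g h : bform L (f + g) h = bform L f h + bform L g h.
Proof. by rewrite /bform !mulmxDl mxE. Qed.

Lemma bformDr L f g h : bform L h (f + g) = bform L h f + bform L h g.
Proof. by rewrite /bform raddfD mulmxDr mxE. Qed.

Lemma bformZl L a f h : bform L (a *: f) h = a * bform L f h.
Proof. by rewrite /bform -!scalemxAl mxE. Qed.

Lemma bformZr L a f h : bform L h (a *: f) = a * bform L h f.
Proof. by rewrite /bform linearZ -!scalemxAr mxE. Qed.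

Lemma bformNl L f h : bform L (- f) h = - bform L f h.
Proof. by rewrite -scaleN1r bformZl mulN1r. Qed.

Lemma bformNr L f h : bform L h (- f) = - bform L h f.
Proof. by rewrite -scaleN1r bformZr mulN1r. Qed.

Lemma bform0l L h : bform L 0 h = 0.
Proof. by rewrite -(scale0r 0) bformZl mul0r. Qed.

Lemma bform0r L h : bform L h 0 = 0.
Proof. by rewrite -(scale0r 0) bformZr mul0r. Qed.

Definition bformE := (bformDl, bformDr, bformNl, bformNr, bformZl, bformZr,
  bform0l, bform0r).

Lemma bform_evec L i j : bform L (evec i) (evec j) = L i j.
Proof.
by rewrite /bform /evec -rowE trmx_delta -colE !mxE.
Qed.

Lemma bform_sum L f g : bform L f g = \sum_i \sum_j f 0 i * L i j * g 0 j.
Proof.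
rewrite /bform mxE exchange_big; apply: eq_bigr => j _; rewrite mxE mulr_suml.
by apply: eq_bigr => i _; rewrite [g^T _ _]mxE.
Qed.

Lemma rowDE f g i : (f + g) 0 i = f 0 i + g 0 i.
Proof. exact: mxE. Qed.

Lemma rowZE (a : int) f i : (a *: f) 0 i = a * f 0 i.
Proof. exact: mxE. Qed.

Lemma evecE i j : evec i 0 j = (i == j)%:R.
Proof. by rewrite mxE eqxx eq_sym. Qed.

Lemma row_evec f : f = \sum_i f 0 i *: evec i.
Proof. exact: row_sum_delta. Qed.

Definition alternating L := forall f g, bform L f g = - bform L g f.

Lemma alternating_skew L : (forall i j, L i j = - L j i) -> alternating L.
Proof.
move=> skL f g; rewrite !bform_sum exchange_big -sumrN; apply: eq_bigr => i _.
by rewrite -sumrN; apply: eq_bigr => j _; rewrite (skL j i); ring.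
Qed.

Lemma alternating0 L f : alternating L -> bform L f f = 0.
Proof. by move/(_ f f) => h; lia. Qed.

(* For v_k = -1, the reflection e_k |-> v.  Locked because [rewrite bformE]
   would otherwise unfold it. *)
Definition refl k v f : 'rV[int]_N :=
  locked (f - f 0 k *: evec k + f 0 k *: v).

Lemma reflE k v f i :
  refl k v f 0 i = f 0 i - f 0 k * (k == i)%:R + f 0 k * v 0 i.
Proof. by rewrite /refl -lock !mxE eqxx eq_sym. Qed.

Lemma reflD k v f g : refl k v (f + g) = refl k v f + refl k v g.
Proof. by apply/rowP=> i; rewrite mxE !reflE !mxE; ring. Qed.

Lemma refl_id k v f : f 0 k = 0 -> refl k v f = f.
Proof. by move=> f0; apply/rowP=> i; rewrite reflE f0; ring. Qed.

Lemma refl_evec k v : refl k v (evec k) = v.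
Proof. by apply/rowP=> i; rewrite reflE !evecE eqxx /=; ring. Qed.

Lemma refl_k k v f : v 0 k = -1 -> refl k v f 0 k = - f 0 k.
Proof. by move=> vk; rewrite reflE vk eqxx /=; ring. Qed.

Lemma reflK k v : v 0 k = -1 -> involutive (refl k v).
Proof.
move=> vk f; apply/rowP=> i; rewrite reflE refl_k // reflE; ring.
Qed.

End Bilinear.

(** * Compatible pairs of integer matrices and their mutation *)

Section IntegerSeeds.
Context {N : nat} (ex : {set 'I_N}) (d : 'I_N -> int).
Implicit Types (L B : 'M[int]_N) (f g h u v : 'rV[int]_N) (i j k : 'I_N).

Definition exch B k : 'rV[int]_N := \row_i B i k.

(** The exponent v of one exchange monomial; the other is v + b^k, by [exch_base_bpos]. *)
Definition exch_base B k : 'rV[int]_N := - evec k - bneg k B.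

Definition mutL k B L : 'M[int]_N := (mutE k B)^T *m L *m mutE k B.

(* Skew-symmetrizability of B is a consequence, see iseed_skew. *)
Record iseed L B : Prop := Iseed {
  iseed_alt : alternating L;
  iseed_pos : forall j, j \in ex -> 0 < d j;
  iseed_compat : forall j g, j \in ex -> bform L (exch B j) g = d j * g 0 j }.

Lemma exchE B k i : exch B k 0 i = B i k.
Proof. exact: mxE. Qed.

Lemma exch_baseE B k i : exch_base B k 0 i = - (k == i)%:R - Num.min (B i k) 0.
Proof. by rewrite rowDE !mxE eqxx (eq_sym i). Qed.

Lemma exch_base_bpos B k : - evec k + bpos k B = exch_base B k + exch B k.
Proof.
apply/rowP=> i; rewrite rowDE [RHS]rowDE exch_baseE exchE mxE evecE mxE.
by rewrite /Num.max /Num.min; case: ltP; lia.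
Qed.

Lemma iseed_diag L B k : iseed L B -> k \in ex -> B k k = 0.
Proof.
move=> sLB kex; have := iseed_compat _ _ sLB k (exch B k) kex.
rewrite (alternating0 _ _ (iseed_alt _ _ sLB)) exchE.
by have := iseed_pos _ _ sLB k kex; nia.
Qed.

Lemma iseed_skew L B i j : iseed L B -> i \in ex -> j \in ex ->
  d i * B i j = - (d j * B j i).
Proof.
move=> sLB iex jex; rewrite -(exchE B j) -(exchE B i) -!(iseed_compat _ _ sLB) //.
exact: (iseed_alt _ _ sLB).
Qed.

Lemma exch_base_k L B k : iseed L B -> k \in ex -> exch_base B k 0 k = -1.
Proof.
by move=> sLB kex; rewrite exch_baseE (iseed_diag _ _ _ sLB) // eqxx minxx.
Qed.

Lemma exch_k L B k : iseed L B -> k \in ex -> exch B k 0 k = 0.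
Proof. by move=> sLB kex; rewrite exchE (iseed_diag _ _ _ sLB). Qed.

(** Column k of [mutE] is [exch_base B k], because [-b]_+ = -[b]_- and b_kk = 0; the other columns
    are standard. *)
Lemma mulmx_mutE L B k f : iseed L B -> k \in ex ->
  f *m (mutE k B)^T = refl k (exch_base B k) f.
Proof.
move=> sLB kex; apply/rowP=> i; rewrite mxE reflE exch_baseE.
rewrite (bigD1 k) //= !mxE eqxx.
have [->|ik] := eqVneq i k.
  rewrite (iseed_diag _ _ _ sLB) // minxx big1 => [|j jk].
    by rewrite /=; ring.
  by rewrite !mxE (negPf jk) eq_sym (negPf jk) mulr0.
rewrite (bigD1 i) //= !mxE eqxx ?(negPf ik) big1 => [|j /andP[jk ji]].
  rewrite /= mulr1 oppr_min oppr0 maxC; ring.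
by rewrite !mxE (negPf jk) eq_sym (negPf ji) mulr0.
Qed.

Lemma bform_mutL L B k f g : iseed L B -> k \in ex ->
  bform (mutL k B L) f g = bform L (refl k (exch_base B k) f) (refl k (exch_base B k) g).
Proof.
move=> sLB kex; rewrite -!(mulmx_mutE L) // /bform /mutL.
by rewrite trmx_mul trmxK !mulmxA.
Qed.

Lemma exch_mutB_k B k : exch (mutB k B) k = - exch B k.
Proof. by apply/rowP=> i; rewrite exchE [RHS]mxE exchE mxE eqxx orbT. Qed.

Lemma exch_base_mutB_k B k : exch_base (mutB k B) k = exch_base B k + exch B k.
Proof.
rewrite -exch_base_bpos; apply/rowP=> i; rewrite exch_baseE rowDE !mxE.
by rewrite eqxx orbT eq_sym oppr_min opprK oppr0.
Qed.

Let half_abs (x y : int) : 0 <= y -> ((`|x| * y + x * `|y|) %/ 2)%Z = y * Num.max x 0.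
Proof.
move=> y0; rewrite (ger0_norm y0) maxC /Num.max; case: ltP => x0.
  have -> : `|x| * y + x * y = (y * x) * 2 by rewrite gtr0_norm //; ring.
  by rewrite mulzK.
by rewrite ler0_norm // mulNr addNr mulr0.
Qed.

Let half_absN (x y : int) : y <= 0 -> ((`|x| * y + x * `|y|) %/ 2)%Z = - (y * Num.min x 0).
Proof.
move=> y0; rewrite (ler0_norm y0) /Num.min; case: ltP => x0.
  have -> : `|x| * y + x * - y = - (y * x) * 2 by rewrite ltr0_norm //; ring.
  by rewrite mulzK.
by rewrite ger0_norm // mulrN subrr mulr0 oppr0.
Qed.

(** For a fixed sign of b_kj column mutation is linear: the sign decides which of the reflections
    e_k |-> v and e_k |-> v + b^k carries b^j to the new column. *)
Lemma exch_mutB_ge0 L B k j : iseed L B -> k \in ex -> j != k -> 0 <= B k j ->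
  exch (mutB k B) j = refl k (exch_base B k + exch B k) (exch B j).
Proof.
move=> sLB kex jk B0; apply/rowP=> i; rewrite -exch_base_bpos reflE rowDE !exchE.
rewrite mxE [(- evec k) 0 i]mxE evecE [bpos k B 0 i]mxE (negPf jk) orbF.
have [->|ik] := eqVneq i k; last by rewrite half_abs //=; ring.
by rewrite (iseed_diag _ _ _ sLB) // maxxx /=; ring.
Qed.

Lemma exch_mutB_le0 L B k j : iseed L B -> k \in ex -> j != k -> B k j <= 0 ->
  exch (mutB k B) j = refl k (exch_base B k) (exch B j).
Proof.
move=> sLB kex jk B0; apply/rowP=> i; rewrite reflE exch_baseE !exchE mxE (negPf jk) orbF.
have [->|ik] := eqVneq i k; last by rewrite half_absN //=; ring.
by rewrite (iseed_diag _ _ _ sLB) // minxx /=; ring.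
Qed.

Lemma iseed_sign L B k j : iseed L B -> k \in ex -> j \in ex ->
  (0 <= B j k) = (B k j <= 0).
Proof.
move=> sLB kex jex; have := iseed_skew _ _ _ _ sLB kex jex.
have := iseed_pos _ _ sLB _ kex; have := iseed_pos _ _ sLB _ jex.
by move=> dj dk e; apply/idP/idP; nia.
Qed.

(** The two reflections differ by f_k b^k, and compatibility turns the two cross terms into d_k f_k
    g_k with opposite signs. Hence the mutated form can be read through either of them. *)
Lemma bform_mutL_flip L B k f g : iseed L B -> k \in ex ->
  bform (mutL k B L) f g =
  bform L (refl k (exch_base B k + exch B k) f) (refl k (exch_base B k + exch B k) g).
Proof.
move=> sLB kex; rewrite (bform_mutL _ _ _ _ _ sLB) //.
have reflb h : refl k (exch_base B k + exch B k) h =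
    refl k (exch_base B k) h + h 0 k *: exch B k.
  by apply/rowP=> i; rewrite rowDE rowZE !reflE rowDE; ring.
rewrite !reflb !bformE !(iseed_compat _ _ sLB) //.
rewrite (iseed_alt _ _ sLB _ (exch B k)) (iseed_compat _ _ sLB) //.
by rewrite (exch_k _ _ _ sLB) // !refl_k ?(exch_base_k _ _ _ sLB) //; ring.
Qed.

(** The form is read through the reflection that produces the new column j. Being an involution it
    returns b^j, so that compatibility reduces to the j-th coordinate of the reflected g, which is
    g_j: the image of e_k has j-th coordinate 0 for that choice of sign. *)
Lemma iseed_mut L B k : iseed L B -> k \in ex -> iseed (mutL k B L) (mutB k B).
Proof.
move=> sLB kex; have vk := exch_base_k _ _ _ sLB kex; have bk := exch_k _ _ _ sLB kex.
split; [|exact: (iseed_pos _ _ sLB)|].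
  by move=> f g; rewrite !(bform_mutL _ _ _ _ _ sLB) // (iseed_alt _ _ sLB).
move=> j g jex; have [->|jk] := eqVneq j k.
  rewrite exch_mutB_k bformNl (bform_mutL _ _ _ _ _ sLB) // (refl_id _ _ (exch B k)) //.
  by rewrite (iseed_compat _ _ sLB) // refl_k //; ring.
have vjE i : i != k -> exch_base B k 0 i = - Num.min (B i k) 0.
  by move=> ik; rewrite exch_baseE eq_sym (negPf ik) oppr0 add0r.
have [B0|B0] := leP (B k j) 0.
  rewrite (exch_mutB_le0 _ _ _ _ sLB) // (bform_mutL _ _ _ _ _ sLB) // reflK //.
  rewrite (iseed_compat _ _ sLB) // reflE vjE // eq_sym (negPf jk).
  by rewrite min_r ?(iseed_sign _ _ _ _ sLB) //=; ring.
have vk' : (exch_base B k + exch B k) 0 k = -1 by rewrite rowDE vk bk.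
rewrite (exch_mutB_ge0 _ _ _ _ sLB) ?ltW // (bform_mutL_flip _ _ _ _ _ sLB) // reflK //.
rewrite (iseed_compat _ _ sLB) // reflE rowDE vjE // exchE eq_sym (negPf jk).
have Bjk : B j k <= 0 by rewrite leNgt lt_def (iseed_sign _ _ _ _ sLB) // [B k j <= 0]leNgt B0 andbF.
by rewrite min_l //=; ring.
Qed.

End IntegerSeeds.

(** * Frames over a division ring *)

Section Frames.
Context {N : nat} {F : unitRingType} (s : F).
Hypotheses (divF : division_ring F) (cs : central s) (s0 : s != 0).
Implicit Types (f g h : 'rV[int]_N) (x y a : F) (L : 'M[int]_N).
Implicit Types (M : 'rV[int]_N -> F) (P Q : 'rV[int]_N -> Prop).

Lemma scalar_unit (a : int) : s ^ a \is a GRing.unit.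
Proof. by rewrite unitrXz // divF. Qed.

Lemma scalarD (a b : int) : s ^ (a + b) = s ^ a * s ^ b.
Proof. by rewrite exprzDr // divF. Qed.

Lemma scalarC (a : int) x : s ^ a * x = x * s ^ a.
Proof. by apply/esym/commrXz/esym/cs. Qed.

Lemma scalar_mulM (a b : int) x y :
  (s ^ a * x) * (s ^ b * y) = s ^ (a + b) * (x * y).
Proof. by rewrite -mulrA (mulrA x) -scalarC scalarD !mulrA. Qed.

Lemma scalarN_mul (a : int) : s ^ (- a) * s ^ a = 1.
Proof. by rewrite -scalarD addNr. Qed.

Definition scalars x := exists r, x = lev s r.

Lemma scalars0 : scalars 0.
Proof. by exists [::]; rewrite /lev big_nil. Qed.

Lemma scalarsX (n a : int) : scalars (n%:~R * s ^ a).
Proof. by exists [:: (n, a)]; rewrite /lev big_seq1. Qed.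

Lemma scalars_exp (a : int) : scalars (s ^ a).
Proof. by rewrite -(mul1r (s ^ a)); exact: (scalarsX 1). Qed.

Lemma scalars1 : scalars 1.
Proof. exact: (scalars_exp 0). Qed.

Lemma scalarsD x y : scalars x -> scalars y -> scalars (x + y).
Proof. by move=> [c ->] [d ->]; exists (c ++ d); rewrite /lev big_cat. Qed.

Lemma scalarsM x y : scalars x -> scalars y -> scalars (x * y).
Proof.
move=> [c ->] [d ->]; exists [seq (p.1 * q.1, p.2 + q.2) | p <- c, q <- d].
rewrite /lev big_allpairs_dep /= mulr_suml; apply: eq_bigr => p _.
rewrite mulr_sumr; apply: eq_bigr => q _ /=.
by rewrite intrM scalarD !mulrA -[_ * s ^ p.2 * _]mulrA scalarC !mulrA.
Qed.

Lemma scalarsN x : scalars x -> scalars (- x).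
Proof.
by rewrite -mulN1r => sx; apply: scalarsM sx; rewrite -[-1]mulr1; apply: (scalarsX (-1) 0).
Qed.

Lemma scalars_central x y : scalars x -> x * y = y * x.
Proof.
move=> [c ->]; rewrite /lev mulr_suml mulr_sumr; apply: eq_bigr => p _.
by rewrite -mulrA scalarC mulrA -(commr_int y p.1) -mulrA.
Qed.

Section OneFrame.
Variable M : 'rV[int]_N -> F.

(** P restricts the support. Exponents may repeat, so no normal form has to be maintained. *)
Inductive span P : F -> Prop :=
| span0 : span P 0
| span_cons a f x : scalars a -> P f -> span P x -> span P (a * M f + x).

Lemma spanD P x y : span P x -> span P y -> span P (x + y).
Proof.
move=> sx sy; elim: sx => [|a f z sa Pf _ ih]; first by rewrite add0r.
by rewrite -addrA; apply: span_cons.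
Qed.

Lemma spanZM P a f : scalars a -> P f -> span P (a * M f).
Proof. by move=> sa Pf; rewrite -[_ * _]addr0; apply: span_cons => //; apply: span0. Qed.

Lemma spanM P f : P f -> span P (M f).
Proof. by move=> Pf; rewrite -[M f]mul1r; apply: spanZM => //; apply: scalars1. Qed.

Lemma spanXM P (a : int) f : P f -> span P (s ^ a * M f).
Proof. by move=> Pf; apply: spanZM => //; apply: scalars_exp. Qed.

Lemma spanZ P a x : scalars a -> span P x -> span P (a * x).
Proof.
move=> sa; elim=> [|b f z sb Pf _ ih]; first by rewrite mulr0; apply: span0.
by rewrite mulrDr mulrA; apply: span_cons => //; apply: scalarsM.
Qed.

Lemma spanN P x : span P x -> span P (- x).
Proof.
by move=> sx; rewrite -mulN1r; apply: spanZ sx; apply/scalarsN/scalars1.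
Qed.

Lemma spanB P x y : span P x -> span P y -> span P (x - y).
Proof. by move=> sx sy; apply/spanD/spanN. Qed.

Lemma spanZV P (a : int) x : span P (s ^ a * x) -> span P x.
Proof.
move/(spanZ _ _ _ (scalars_exp (- a))).
by rewrite mulrA scalarN_mul mul1r.
Qed.

Lemma span_sub P Q x : (forall f, P f -> Q f) -> span P x -> span Q x.
Proof.
move=> PQ; elim=> [|a f z sa Pf _ ih]; first exact: span0.
by apply: span_cons => //; apply: PQ.
Qed.

Lemma span_split P (b : 'rV[int]_N -> bool) x : span P x ->
  exists x1 x2, [/\ x = x1 + x2, span (fun f => P f /\ b f) x1
                  & span (fun f => P f /\ ~~ b f) x2].
Proof.
elim=> [|a f z sa Pf _ [x1 [x2 [-> s1 s2]]]].
  by exists 0, 0; split; rewrite ?addr0 //; apply: span0.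
have [bf|bf] := boolP (b f).
  exists (a * M f + x1), x2; split; rewrite ?addrA //.
  by apply: span_cons.
exists x1, (a * M f + x2); split; rewrite ?addrA ?(addrC _ x1) -?addrA //.
by apply: span_cons.
Qed.

Lemma span_bind P (R : F -> Prop) x :
  R 0 -> (forall x y, R x -> R y -> R (x + y)) ->
  (forall a f, scalars a -> P f -> R (a * M f)) -> span P x -> R x.
Proof. by move=> R0 RD RM; elim=> // a f z sa Pf _ Rz; apply: RD => //; apply: RM. Qed.

End OneFrame.

Arguments span_split {M P} b {x}.

(** L is an exact integer matrix and nothing is said of the order of s, so the quantum and the root
    of unity case are treated at once. *)
Record frame M L : Prop := Frame {
  frame_alt : alternating L;
  frame0 : M 0 = 1;
  frameM : forall f g, M f * M g = s ^ bform L f g * M (f + g);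
  frame_free : forall a f x, scalars a -> span M (fun g => g <> f) x ->
    a * M f + x = 0 -> a = 0 }.

Arguments frame_alt {M L}.
Arguments frame0 {M L}.
Arguments frameM {M L}.
Arguments frame_free {M L}.

Section FrameTheory.
Context {M : 'rV[int]_N -> F} {L : 'M[int]_N}.
Hypothesis fM : frame M L.

Lemma frame_add f g : M (f + g) = s ^ (- bform L f g) * (M f * M g).
Proof. by rewrite (frameM fM) mulrA scalarN_mul mul1r. Qed.

Lemma monoM (a b : int) f g :
  (s ^ a * M f) * (s ^ b * M g) = s ^ (a + b + bform L f g) * M (f + g).
Proof.
by rewrite scalar_mulM (frameM fM) mulrA -scalarD.
Qed.

Lemma frameC f g : M f * M g = s ^ (2 * bform L f g) * (M g * M f).
Proof.
rewrite !(frameM fM) mulrA -scalarD (addrC g f); congr (s ^ _ * _).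
by rewrite (frame_alt fM g f); ring.
Qed.

Lemma frameN_mul f : M (- f) * M f = 1.
Proof.
rewrite (frameM fM) bformNl (alternating0 _ _ (frame_alt fM)) addNr.
by rewrite (frame0 fM) mulr1.
Qed.

Lemma frame_mulN f : M f * M (- f) = 1.
Proof. by have := frameN_mul (- f); rewrite opprK. Qed.

Lemma frame_unit f : M f \is a GRing.unit.
Proof. by apply/unitrP; exists (M (- f)); rewrite frameN_mul frame_mulN. Qed.

Lemma frameV f : (M f)^-1 = M (- f).
Proof. by apply: (mulrI (frame_unit f)); rewrite mulrV ?frame_unit // frame_mulN. Qed.

Lemma frame_exp f (n : int) : M f ^ n = M (n *: f).
Proof.
have expn (m : nat) : M f ^+ m = M ((m : int) *: f).
  elim: m => [|m ih]; first by rewrite expr0 scale0r (frame0 fM).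
  rewrite exprS ih (frameM fM) bformZr (alternating0 _ _ (frame_alt fM)) mulr0 mul1r.
  by rewrite intS scalerDl scale1r.
case: n => m; first exact: expn.
by rewrite NegzE -exprnN expn frameV scaleNr.
Qed.

(** Linear independence in the form used below, with terms told apart by a condition on exponents.
    The terms with the first exponent f are collected; as Q misses f their total coefficient is 0,
    and fewer terms remain. *)
Lemma span_disjoint P Q x :
  (forall f, P f -> Q f -> False) -> span M P x -> span M Q x -> x = 0.
Proof.
move=> PQ sP; have [m] : exists m, (fun m => exists c : seq (F * 'rV[int]_N),
    [/\ size c = m, forall p, p \in c -> scalars p.1 /\ P p.2 &
        x = \sum_(p <- c) p.1 * M p.2]) m.
  elim: sP => [|a f z sa Pf _ [m [c [sc hc ->]]]].
    by exists 0%N, [::]; rewrite big_nil.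
  exists m.+1, ((a, f) :: c); split; rewrite ?big_cons //= ?sc // => p.
  by rewrite inE => /predU1P[->|/hc].
elim/ltn_ind: m x {sP} => m ih x [c [sc hc ->]] sQ.
case: c sc hc sQ => [|[a f] c] sc hc sQ; first by rewrite big_nil.
have [sa Pf] := hc (a, f) (mem_head _ _); rewrite /= in sa Pf.
pose c' := [seq p <- c | p.2 != f].
have subc p : p \in c -> scalars p.1 /\ P p.2.
  by move=> pc; apply: hc; rewrite inE pc orbT.
have subc' p : p \in c' -> scalars p.1 /\ P p.2.
  by rewrite mem_filter => /andP[_ /subc].
pose b := a + \sum_(p <- c | p.2 == f) p.1.
have eqx : \sum_(p <- (a, f) :: c) p.1 * M p.2 = b * M f + \sum_(p <- c') p.1 * M p.2.
  rewrite big_cons /= (bigID (fun p => p.2 == f)) /= addrA big_filter /b mulrDl.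
  congr (_ + _ + _); rewrite mulr_suml; apply: eq_bigr => p /eqP -> //.
have sb : scalars b.
  apply: scalarsD => //; rewrite big_seq_cond.
  apply: big_ind; [exact: scalars0|exact: scalarsD|].
  by move=> p /andP[/subc[]].
have sc' : span M (fun g => g <> f) (\sum_(p <- c') p.1 * M p.2).
  rewrite big_seq; apply: big_ind; [exact: span0|exact: spanD|].
  move=> p pc'; have [sp _] := subc' _ pc'; apply: spanZM => //.
  by move: pc'; rewrite mem_filter => /andP[/eqP].
have b0 : b = 0.
  apply: (frame_free fM _ f (\sum_(p <- c') p.1 * M p.2
      - \sum_(p <- (a, f) :: c) p.1 * M p.2) sb).
    apply: spanB => //; apply: span_sub sQ => g Qg gf.
    by apply: (PQ f) => //; rewrite -gf.
  by rewrite eqx addrA subrr.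
rewrite eqx b0 mul0r add0r in sQ *.
apply: (ih (size c')) => //; last by exists c'.
by rewrite -sc /= ltnS size_filter count_size.
Qed.

Lemma span_mulr P Q f x :
  (forall g, P g -> Q (g + f)) -> span M P x -> span M Q (x * M f).
Proof.
move=> PQ; elim=> [|a g z sa Pg _ ih]; first by rewrite mul0r; apply: span0.
rewrite mulrDl; apply: spanD => //.
rewrite -mulrA (frameM fM) mulrA; apply: spanZM; last exact: PQ.
by apply: scalarsM => //; apply: scalars_exp.
Qed.

Lemma span_mul P1 P2 Q x y :
  (forall f g, P1 f -> P2 g -> Q (f + g)) -> span M P1 x -> span M P2 y ->
  span M Q (x * y).
Proof.
move=> PQ s1 s2; elim: s2 => [|a g z sa Pg _ ih]; first by rewrite mulr0; apply: span0.
rewrite mulrDr; apply: spanD => //.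
rewrite mulrA -(scalars_central _ x sa) -mulrA; apply: spanZ => //.
by apply: span_mulr s1 => f Pf; apply: PQ.
Qed.

End FrameTheory.

(** * Mutation of frames *)

Section Adjacency.
Implicit Types (i j k : 'I_N) (v b u w : 'rV[int]_N).

(* Seeds related by the mutation in direction k, with exchange relation
   M'(e_k) = M(v) + M(v + b).  The pairs (v, b) and (v + b, -b) describe the
   same mutation; reading it backwards keeps (v, b). *)
Record adj k v b M L M' L' : Prop := Adj {
  adj_v : v 0 k = -1;
  adj_b : b 0 k = 0;
  adj_compat : exists2 d : int, d != 0 & forall g, bform L b g = d * g 0 k;
  adj_form : forall f g, bform L' f g = bform L (refl k v f) (refl k v g);
  adj_other : forall f, f 0 k = 0 -> M' f = M f;
  adj_new : M' (evec k) = M v + M (v + b) }.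

Arguments adj_v {k v b M L M' L'}.
Arguments adj_b {k v b M L M' L'}.
Arguments adj_compat {k v b M L M' L'}.
Arguments adj_form {k v b M L M' L'}.
Arguments adj_other {k v b M L M' L'}.
Arguments adj_new {k v b M L M' L'}.

Lemma adj_flip k v b M L M' L' : alternating L ->
  adj k v b M L M' L' -> adj k (v + b) (- b) M L M' L'.
Proof.
move=> altL [vk bk [d d0 hd] hL hM hk]; split.
- by rewrite mxE vk bk.
- by rewrite mxE bk oppr0.
- by exists (- d); rewrite ?oppr_eq0 // => g; rewrite bformNl hd mulNr.
- have reflDb f : refl k (v + b) f = refl k v f + f 0 k *: b.
    by apply/rowP=> i; rewrite !mxE !reflE !mxE; ring.
  move=> f g; rewrite hL !reflDb !bformE !hd (altL _ b) hd.
  by rewrite !refl_k // bk; ring.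
- exact: hM.
- by rewrite hk addrK addrC.
Qed.

(** The relation M(e_k) = M'(v) + M'(v + b) is checked after right multiplication by M'(e_k); the
    powers of s match because L(b, v) = L(e_k, b) = -d. The constant d changes sign. *)
Lemma adj_sym k v b M L M' L' : frame M L -> frame M' L' ->
  adj k v b M L M' L' -> adj k v b M' L' M L.
Proof.
move=> fM fM' [vk bk [d d0 hd] hL hM hk].
split=> //.
- exists (- d); rewrite ?oppr_eq0 // => g.
  by rewrite hL (refl_id _ _ b) // hd refl_k // mulrN mulNr.
- by move=> f g; rewrite hL !reflK.
- by move=> f f0; rewrite hM.
- apply: (mulIr (frame_unit fM' (evec k))).
  rewrite {1}hk mulrDr mulrDl !(frameM fM) !(frameM fM').
  have reflv : refl k v v = evec k by rewrite -{2}(refl_evec k v) reflK.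
  rewrite !hL reflD refl_evec reflv (refl_id _ _ b) //.
  rewrite !(addrC (evec k)) !hM; try by rewrite !mxE !eqxx ?vk ?bk.
  congr (_ + s ^ _ * _); rewrite !bformE hd (frame_alt fM (evec k) b) hd.
  by rewrite vk evecE eqxx /=; ring.
Qed.

(** The leading coefficient is exactly 1, without a power of s, since L' is L read through [refl].
    Two such leading terms can thus recombine into an exchange polynomial. *)
Lemma adj_expand k v b M L M' L' f (n : nat) : frame M L -> frame M' L' ->
  adj k v b M L M' L' -> f 0 k = n%:Z ->
  exists2 y, M' f = M (refl k v f) + y &
    span M (fun g => exists2 j : nat, (0 < j <= n)%N & g = refl k v f + j%:Z *: b) y.
Proof.
move=> fM fM' adjM; have [vk bk _ hL hM hk] := adjM.
elim: n f => [|n ih] f fk.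
  by exists 0; [rewrite refl_id // hM // addr0 | apply: span0].
pose f' := f - evec k.
have f'k : f' 0 k = n%:Z by rewrite !mxE fk !eqxx /=; lia.
have [y eqy sy] := ih f' f'k.
have ef : f = f' + evec k by rewrite /f' subrK.
have rf : refl k v f = refl k v f' + v by rewrite {1}ef reflD refl_evec.
exists (s ^ (- bform L' f' (evec k)) *
  (M (refl k v f') * M (v + b) + y * (M v + M (v + b)))).
  rewrite {1}ef (frame_add fM') eqy hk mulrDl [M _ * (_ + _)]mulrDr -addrA mulrDr; congr (_ + _).
  rewrite (frameM fM) mulrA -scalarD hL refl_evec addNr mul1r rf //.
apply: spanZ; first exact: scalars_exp.
apply: spanD; last rewrite mulrDr; last apply: spanD.
- rewrite (frameM fM); apply: spanXM; exists 1%N => //.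
  by rewrite rf scale1r addrA.
- apply: (span_mulr fM) sy => g [j /andP[j0 jn] ->]; exists j.
    by rewrite j0 ltnW.
  by rewrite rf addrAC.
- apply: (span_mulr fM) sy => g [j /andP[j0 jn] ->]; exists j.+1 => //.
  by rewrite rf intS scalerDl scale1r; apply/rowP=> i; rewrite !mxE; ring.
Qed.

Lemma adj_monomial k v b M L M' L' f : frame M L -> frame M' L' ->
  adj k v b M L M' L' -> 0 <= f 0 k ->
  span M (fun g => exists j : nat, g = refl k v f + j%:Z *: b) (M' f).
Proof.
move=> fM fM' adjM f0.
have fk : f 0 k = (absz (f 0 k))%:Z by lia.
have [y -> sy] := adj_expand _ _ _ _ _ _ _ _ _ fM fM' adjM fk.
apply: spanD; first by apply: spanM; exists 0%N; rewrite scale0r addr0.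
by apply: span_sub sy => g [j _ ->]; exists j.
Qed.

Lemma adj_span k v b M L M' L' P Q x : frame M L -> frame M' L' ->
  adj k v b M L M' L' -> (forall f, P f -> 0 <= f 0 k) ->
  (forall f (j : nat), P f -> Q (refl k v f + j%:Z *: b)) ->
  span M' P x -> span M Q x.
Proof.
move=> fM fM' adjM P0 PQ; apply: span_bind; [exact: span0|exact: spanD|].
move=> a f sa Pf; apply: spanZ => //.
apply: span_sub (adj_monomial _ _ _ _ _ _ _ _ fM fM' adjM (P0 f Pf)).
by move=> g [j ->]; apply: PQ.
Qed.

Lemma span_bounded M P (phi : 'rV[int]_N -> int) x : span M P x ->
  exists n : nat, span M (fun f => P f /\ - n%:Z <= phi f <= n%:Z) x.
Proof.
elim=> [|a f z sa Pf _ [n sn]]; first by exists 0%N; apply: span0.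
exists (maxn n (absz (phi f))); apply: span_cons => //.
  by split=> //; lia.
by apply: span_sub sn => g [Pg gn]; split=> //; lia.
Qed.

Lemma span_exp M L P x (n : nat) : frame M L -> P 0 ->
  (forall f g, P f -> P g -> P (f + g)) -> span M P x -> span M P (x ^+ n).
Proof.
move=> fM P0 PD sx; elim: n => [|n ih].
  by rewrite expr0 -(frame0 fM); apply: spanM.
by rewrite exprS; apply: (span_mul fM) sx ih.
Qed.

Lemma twist_exp (x y : F) (c n : int) : x \is a GRing.unit ->
  x * y = s ^ c * (y * x) -> x ^ n * y = s ^ (c * n) * (y * x ^ n).
Proof.
move=> ux xy.
have expn m : x ^+ m * y = s ^ (c * m%:Z) * (y * x ^+ m).
  elim: m => [|m ih]; first by rewrite mulr0 !mul1r mulr1.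
  rewrite exprSr -mulrA xy mulrA -scalarC -mulrA [x ^+ m * _]mulrA ih.
  by rewrite intS mulrDr mulr1 scalarD -!mulrA.
case: n => m; first exact: expn.
rewrite NegzE -exprnN; have uxm : x ^+ m.+1 \is a GRing.unit by rewrite unitrX.
apply: (mulrI uxm); apply: (mulIr uxm).
rewrite mulrA mulrV // mul1r mulrA -scalarC -!mulrA mulVr // mulr1 expn.
by rewrite mulrA -scalarD mulrN addNr mul1r.
Qed.

(** * Construction of the mutated frame *)

Section Mutate.
Variables (k : 'I_N) (v b : 'rV[int]_N) (M : 'rV[int]_N -> F) (L L' : 'M[int]_N).
Hypotheses (fM : frame M L) (vk : v 0 k = -1) (bk : b 0 k = 0).
Hypothesis compat : exists2 d : int, d != 0 & forall g, bform L b g = d * g 0 k.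
Hypothesis form : forall f g, bform L' f g = bform L (refl k v f) (refl k v g).

Let X := M v + M (v + b).
Let rest f := f - f 0 k *: evec k.

(** The formula is forced: M' agrees with M on the part of f away from e_k and sends e_k to X, and
    the power of s is the one that the frame relation for L' prescribes. *)
Definition mutate f := s ^ (- (f 0 k * bform L (rest f) v)) * (M (rest f) * X ^ f 0 k).

Let rest_k f : rest f 0 k = 0.
Proof. by rewrite !mxE !eqxx /=; ring. Qed.

Let restD f g : rest (f + g) = rest f + rest g.
Proof. by apply/rowP=> i; rewrite !mxE; ring. Qed.

Let rest_id f : f 0 k = 0 -> rest f = f.
Proof. by move=> f0; rewrite /rest f0 scale0r subr0. Qed.

Let X_unit : X \is a GRing.unit.
Proof.
apply: divF; apply/eqP; rewrite /X => X0.
have: (1 : F) = 0.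
  apply: (frame_free fM 1 v (M (v + b))); [exact: scalars1| |by rewrite mul1r].
  apply: spanM => vb; have [d d0 /(_ (evec k))] := compat.
  have -> : b = 0 by rewrite -[b](addKr v) vb addNr.
  by rewrite bform0l evecE eqxx mulr1 => dk; rewrite -dk eqxx in d0.
by apply/eqP; rewrite oner_eq0.
Qed.

(** Both monomials of X commute with M(h) up to the same scalar, as L(b, h) = d h_k = 0. *)
Let X_twist h (n : int) : h 0 k = 0 ->
  X ^ n * M h = s ^ (2 * bform L v h * n) * (M h * X ^ n).
Proof.
move=> hk; apply: twist_exp => //.
have [d _ hd] := compat.
rewrite mulrDl (frameC fM v) (frameC fM (v + b)) bformDl hd hk mulr0 addr0.
by rewrite -!mulrDr.
Qed.

Let mutate_mulX f (n : int) : mutate f * X ^ n =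
  s ^ (- (f 0 k * bform L (rest f) v)) * (M (rest f) * X ^ (f 0 k + n)).
Proof. by rewrite /mutate exprzDr ?X_unit // !mulrA. Qed.

Let span_X (n : int) : 0 <= n -> span M (fun g => g 0 k = - n) (X ^ n).
Proof.
case: n => // n _; elim: n => [|n ih].
  by rewrite expr0z -(frame0 fM); apply: spanM; rewrite mxE oppr0.
change (span M (fun g => g 0 k = - n.+1%:Z) (X ^+ n.+1)); rewrite exprSr.
apply: (span_mul fM) ih _ => [f g fk gk|].
  by instantiate (1 := fun g => g 0 k = -1) in gk; rewrite mxE fk gk; lia.
by apply: spanD; apply: spanM; rewrite ?mxE vk ?bk.
Qed.

Let span_mulX P Q x (n : int) : (forall g, P g -> 0 <= g 0 k + n) ->
  (forall g h, P g -> h 0 k = - (g 0 k + n) -> Q h) ->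
  span mutate P x -> span M Q (x * X ^ n).
Proof.
move=> Pn PQ; elim=> [|a f z sa Pf _ ih]; first by rewrite mul0r; apply: span0.
rewrite mulrDl; apply: spanD => //; rewrite -mulrA mutate_mulX.
apply: spanZ => //; apply: spanZ; first exact: scalars_exp.
apply: (span_mul fM) (spanM M (fun g => g 0 k = 0) _ (rest_k f)) (span_X _ (Pn _ Pf)).
by move=> g h gk hk; apply: (PQ f) => //; rewrite mxE gk add0r.
Qed.

Lemma mutate_frame : frame mutate L'.
Proof.
split.
- by move=> f g; rewrite !form (frame_alt fM).
- rewrite /mutate rest_id mxE // (frame0 fM) mul0r.
  by rewrite oppr0 !mul1r.
- move=> f g; rewrite /mutate; set m := f 0 k; set n := g 0 k.
  rewrite scalar_mulM -(mulrA (M _)) (mulrA (X ^ m)) X_twist //.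
  rewrite -(mulrA (s ^ _)) (mulrA (M _) (s ^ _)) -scalarC -!(mulrA (s ^ _)).
  rewrite -(mulrA (M _)) (mulrA (M (rest f))) (frameM fM) -restD.
  rewrite -(mulrA (s ^ _)) -exprzDr ?X_unit // !(mulrA (s ^ _)) -!scalarD.
  have -> : (f + g) 0 k = m + n by rewrite mxE.
  rewrite -(mulrA (s ^ bform L _ _)) mulrA -scalarD; congr (s ^ _ * _).
  rewrite form.
  have reflr h : refl k v h = rest h + h 0 k *: v.
    by apply/rowP=> i; rewrite reflE !mxE eqxx eq_sym; ring.
  rewrite !reflr restD -/m -/n; move: (rest f) (rest g) => f0 g0.
  by rewrite !bformE (alternating0 _ v (frame_alt fM)) (frame_alt fM v); ring.
(* Multiplication by X^K clears the negative powers of X. As X^n is homogeneous of degree -n in the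
   k-th exponent, terms with different g_k separate. Those with g_k = f_k are then stripped of X,
   and the independence of M applies. *)
- move=> a f x sa sx e0.
  have [m sm] := span_bounded _ _ (fun g => g 0 k) _ sx.
  pose K : int := (maxn m (absz (f 0 k)))%:Z.
  have [x1 [x2 [ex s1 s2]]] := span_split (fun g : 'rV[int]_N => g 0 k == f 0 k) sm.
  have e1 : a * mutate f + x1 = 0.
    apply: (mulIr (unitrXz K X_unit)); rewrite mul0r.
    pose P (h : 'rV[int]_N) := h 0 k = - (f 0 k + K).
    apply: (span_disjoint fM P (fun h => ~ P h)) => [//| |].
      apply: (span_mulX (fun g => g 0 k = f 0 k)) => [g ->|g h -> //|].
        by rewrite /K; lia.
      apply: span_cons => //; apply: span_sub s1.
      by move=> g [_ /eqP].
    have -> : a * mutate f + x1 = - x2.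
      by apply/eqP; rewrite -addr_eq0 -addrA -ex e0.
    apply: (span_mulX (fun g => - m%:Z <= g 0 k /\ g 0 k <> f 0 k)).
    - by move=> g [gm _]; rewrite /K; lia.
    - by move=> g h [gm gf] hk; rewrite /P hk; lia.
    - by apply: spanN; apply: span_sub s2 => g [[_ /andP[gm _]] /eqP gf].
  have {}e1 : (a * mutate f + x1) * X ^ (- f 0 k) = 0 by rewrite e1 mul0r.
  rewrite mulrDl -mulrA mutate_mulX subrr mulr1 mulrA in e1.
  have a0 : a * s ^ (- (f 0 k * bform L (rest f) v)) = 0.
    apply: (frame_free fM _ (rest f) _ _ _ e1).
      by apply: scalarsM => //; apply: scalars_exp.
    elim: s1 => [|c g z sc [[gf _] /eqP gk] _ ih].
      by rewrite mul0r; apply: span0.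
    rewrite mulrDl; apply: spanD => //; rewrite -mulrA mutate_mulX gk subrr mulr1.
    apply: spanZ => //; apply: spanXM => rgf; apply: gf.
    by move: rgf; rewrite /rest gk; apply: addIr.
  by apply: (mulIr (scalar_unit (- (f 0 k * bform L (rest f) v)))); rewrite a0 mul0r.
Qed.

Lemma mutate_adj : adj k v b M L mutate L'.
Proof.
split=> // [f fk|].
  by rewrite /mutate fk rest_id // mul0r oppr0 mul1r mulr1.
have -> : mutate (evec k) = X; last by [].
have r0 : rest (evec k) = 0.
  by apply/rowP=> i; rewrite !mxE !eqxx /=; ring.
by rewrite /mutate r0 bform0l mulr0 oppr0 mul1r (frame0 fM) mul1r evecE eqxx.
Qed.

End Mutate.

(** * Elements that are Laurent in two adjacent frames *)

Definition laurent M := span M (fun _ => True).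

Lemma span_laurent M P x : span M P x -> laurent M x.
Proof. exact: span_sub. Qed.

Lemma laurentM M L x y : frame M L -> laurent M x -> laurent M y -> laurent M (x * y).
Proof. by move=> fM; apply: (span_mul fM). Qed.

Lemma laurent_mono M f : laurent M (M f).
Proof. exact: spanM. Qed.

Lemma adj_laurent k v b M L M' L' x : frame M L -> frame M' L' ->
  adj k v b M L M' L' -> span M' (fun f => 0 <= f 0 k) x -> laurent M x.
Proof. by move=> fM fM' adjM; apply: (adj_span _ _ _ _ _ _ _ _ _ _ fM fM' adjM). Qed.

(* A common Laurent polynomial splits because powers of M'(e_k) are homogeneous
   of opposite degree in the two gradings by the k-th exponent. *)
Lemma laurent_split k v b M L M' L' x : frame M L -> frame M' L' ->
  adj k v b M L M' L' -> laurent M x -> laurent M' x ->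
  exists y z, [/\ x = y + z, span M (fun f => 0 <= f 0 k) y
                & span M' (fun f => 0 <= f 0 k) z].
Proof.
move=> fM fM' adjM lx lx'.
have [x1 [x2 [ex s1 s2]]] := span_split (fun f : 'rV[int]_N => 0 <= f 0 k) lx.
(* Strict here, but not in the splitting above: k-th exponent 0 must be counted on one side only. *)
have [y1 [y2 [ey t1 t2]]] := span_split (fun f : 'rV[int]_N => 0 < f 0 k) lx'.
have [n tn] := span_bounded _ _ (fun f => f 0 k) _ t2.
exists x1, y1; split; last 2 [by apply: span_sub s1 => f []].
- rewrite ex; congr (_ + _).
  (* M'(h) has k-th exponent -n in M. In x2 - y1 = y2 - x1, multiplied by M'(h), the k-th exponents
     in M are below -n on the left and at least -n on the right, so both sides vanish. *)
  pose h : 'rV[int]_N := n%:Z *: evec k.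
  have hk : h 0 k = n%:Z by rewrite !mxE !eqxx /= mulr1.
  have vk := adj_v adjM; have bk := adj_b adjM.
  have sh : span M (fun f => f 0 k = - n%:Z) (M' h).
    have h0 : 0 <= h 0 k by rewrite hk.
    apply: span_sub (adj_monomial _ _ _ _ _ _ _ _ fM fM' adjM h0).
    by move=> g [j ->]; rewrite mxE refl_k // hk mxE bk mulr0 addr0.
  apply/eqP; rewrite -subr_eq0; apply/eqP.
  apply: (mulIr (frame_unit fM' h)); rewrite mul0r.
  apply: (span_disjoint fM (fun f => f 0 k < - n%:Z) (fun f => - n%:Z <= f 0 k)).
  - by move=> f; lia.
  - rewrite mulrBl; apply: spanB.
      by apply: (span_mul fM) s2 sh => f g [_ f0] g0; rewrite rowDE g0; lia.
    apply: (adj_span _ _ _ _ _ _ _ (fun f => n%:Z < f 0 k) _ _ fM fM' adjM).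
    + by move=> f /=; lia.
    + by move=> f j fn; rewrite /= rowDE refl_k // rowZE bk; move: fn => /=; lia.
    + by apply: (span_mulr fM') t1 => f [_ f0]; rewrite rowDE hk; lia.
  - have -> : x2 - y1 = y2 - x1.
      by apply/eqP; rewrite subr_eq addrAC -subr_eq opprK (addrC x2) -ex (addrC y2) ey.
    rewrite mulrBl; apply: spanB.
      apply: (adj_span _ _ _ _ _ _ _ (fun f => 0 <= f 0 k <= n%:Z) _ _ fM fM' adjM).
      + by move=> f /=; lia.
      + by move=> f j fn; rewrite /= rowDE refl_k // rowZE bk; move: fn => /=; lia.
      + by apply: (span_mulr fM') tn => f [[_ f0] fn]; rewrite rowDE hk; lia.
    by apply: (span_mul fM) s1 sh => f g [_ f0] g0; rewrite rowDE g0; lia.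
- by apply: span_sub t1 => f [_ /ltW].
Qed.

(** * Gradings in which an exchange relation is homogeneous *)

Section Graded.
Variables (k : 'I_N) (v b : 'rV[int]_N) (M M' : 'rV[int]_N -> F) (L L' : 'M[int]_N).
Hypotheses (fM : frame M L) (fM' : frame M' L') (adjM : adj k v b M L M' L').
Variable phi : 'rV[int]_N -> int.
Hypothesis phiD : forall f g, phi (f + g) = phi f + phi g.
Hypothesis phib : forall j : nat, phi (j%:Z *: b) = 0.

(** When M'(f) is given the degree of [refl k v f], expansion in M preserves degrees, because b has
    degree 0. By [laurent_split] the sum is a part polynomial in M(e_k) plus one polynomial in
    M'(e_k), and each is cut by degree in its own frame. *)
Lemma graded_component (p : int -> bool) x y :
  span M (fun f => p (phi f)) x -> span M (fun f => ~~ p (phi f)) y ->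
  laurent M' (x + y) -> laurent M' x.
Proof.
move=> sx sy lxy.
have lxy' : laurent M (x + y) by apply: spanD; [move: sx|move: sy]; apply: span_sub.
have [z [t [e sz st]]] := laurent_split _ _ _ _ _ _ _ _ fM fM' adjM lxy' lxy.
have [z1 [z2 [ez sz1 sz2]]] := span_split (fun f => p (phi f)) sz.
have [t1 [t2 [et st1 st2]]] := span_split (fun f => p (phi (refl k v f))) st.
suff -> : x = z1 + t1.
  apply: spanD; last exact: span_laurent st1.
  apply: (adj_laurent _ _ _ _ _ _ _ _ fM' fM (adj_sym _ _ _ _ _ _ _ fM fM' adjM)).
  by apply: span_sub sz1 => f [].
apply/eqP; rewrite -subr_eq0; apply/eqP.
apply: (span_disjoint fM (fun f => p (phi f)) (fun f => ~~ p (phi f))).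
- by move=> f -> .
- apply: spanB => //; apply: spanD; first by apply: span_sub sz1 => f [].
  apply: (adj_span _ _ _ _ _ _ _ _ _ _ fM fM' adjM) st1 => f; first by case.
  by move=> j [_ pf]; rewrite phiD phib addr0.
- have -> : x - (z1 + t1) = (z2 + t2) - y.
    apply/eqP; rewrite subr_eq addrAC -subr_eq opprK e ez et.
    by rewrite addrACA [X in _ == X]addrC.
  apply: spanB => //; apply: spanD; first by apply: span_sub sz2 => f [].
  apply: (adj_span _ _ _ _ _ _ _ _ _ _ fM fM' adjM) st2 => f; first by case.
  by move=> j [_ pf]; rewrite phiD phib addr0.
Qed.

(* The factor 1 + c M(w) is 1 plus terms of positive phi-degree, so it is
   cancelled by peeling off the components of x from the lowest degree up. *)
Lemma laurent_cancel w (c : int) x : 0 <= w 0 k -> 0 < phi w ->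
  laurent M x -> laurent M' ((1 + s ^ c * M w) * x) -> laurent M' x.
Proof.
move=> wk phiw /(span_bounded _ _ phi)[n sx].
(* The degrees -n, ..., n form a window of width 2n + 1, and the induction is on the width. *)
have {sx} : span M (fun f => - n%:Z <= phi f < - n%:Z + (n.*2.+1)%:Z) x.
  by apply: span_sub sx => f [_ fn]; lia.
move: (- n%:Z) n.*2.+1 => a m.
elim: m a x => [|m ih] a x sx lx.
  suff -> : x = 0 by apply: span0.
  by apply: (span_disjoint fM _ (fun _ => False) _ _ sx) => //; apply: span_sub sx => f /=; lia.
have [x1 [x2 [ex s1 s2]]] := span_split (fun f => phi f == a) sx.
have s1' : span M (fun f => phi f == a) x1 by apply: span_sub s1 => f [].
have s2' : span M (fun f => a + 1 <= phi f < a + 1 + m%:Z) x2.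
  by apply: span_sub s2 => f [fa /eqP f0]; lia.
have lw : laurent M' (1 + s ^ c * M w).
  apply: (adj_laurent _ _ _ _ _ _ _ _ fM' fM (adj_sym _ _ _ _ _ _ _ fM fM' adjM)).
  by rewrite -(frame0 fM); apply: spanD; [apply: spanM; rewrite mxE | apply: spanXM].
have l1 : laurent M' x1.
  apply: (graded_component (fun z => z == a) _ (x2 + s ^ c * M w * x) s1').
    apply: spanD; first by apply: span_sub s2' => f fa; apply/eqP; lia.
    rewrite -mulrA; apply: spanZ; first exact: scalars_exp.
    apply: (span_mul fM _ _ _ _ _ _ (spanM M (fun f => f = w) _ _)) sx => // f g -> ga.
    by rewrite phiD; apply/eqP; lia.
  by rewrite addrA -ex -{1}[x]mul1r -mulrDl.
rewrite ex; apply: spanD => //; apply: (ih (a + 1)) => //.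
have -> : (1 + s ^ c * M w) * x2 = (1 + s ^ c * M w) * x - (1 + s ^ c * M w) * x1.
  by rewrite -mulrBr ex addrAC subrr add0r.
by apply: spanB => //; apply: (laurentM _ _ _ _ fM').
Qed.

End Graded.

Arguments adj_sym {k v b M L M' L'}.
Arguments adj_expand {k v b M L M' L' f n}.
Arguments adj_monomial {k v b M L M' L' f}.
Arguments adj_laurent {k v b M L M' L' x}.
Arguments laurent_split {k v b M L M' L' x}.
Arguments laurentM {M L x y}.

Lemma frame_rest M L k f : frame M L ->
  M f = s ^ (- bform L (f - f 0 k *: evec k) (f 0 k *: evec k)) *
    (M (f - f 0 k *: evec k) * M (evec k) ^ f 0 k).
Proof. by move=> fM; rewrite (frame_exp fM) -(frame_add fM) subrK. Qed.

(* The frames form a path M2 -j- M -i- M' -j- M''.  Of the two orientations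
   (v, w) of the exchange relation in direction i, the one chosen makes E b = b',
   where E is the reflection e_i |-> v. *)
Section Square.
Variables (i j : 'I_N) (v w p b p' b' : 'rV[int]_N).
Variables (M M' M2 M'' : 'rV[int]_N -> F) (L L' L2 L'' : 'M[int]_N).
Hypotheses (fM : frame M L) (fM' : frame M' L') (fM2 : frame M2 L2)
  (fM'' : frame M'' L'').
Hypotheses (adji : adj i v w M L M' L') (adjj : adj j p b M L M2 L2)
  (adjj' : adj j p' b' M' L' M'' L'').
Hypotheses (ij : i != j) (vj : v 0 j = 0) (wj : 0 <= w 0 j).
Hypothesis reflb : refl i v b = b'.
Hypotheses (p_ge0 : 0 <= p 0 i) (pb_ge0 : 0 <= (p + b) 0 i).
(** In the application w = b^i or -b^i. If w_j = 0 then b_ji = b_ij = 0, and the exchange relation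
    in direction j does not involve e_i. *)
Hypothesis wj_pos : 0 < w 0 j \/ p 0 i = 0 /\ (p + b) 0 i = 0.

Let adji' := adj_sym fM fM' adji.
Let adjj'' := adj_sym fM' fM'' adjj'.

Let refl_j h : refl i v h 0 j = h 0 j.
Proof. by rewrite reflE vj (negPf ij) !mulr0 subr0 addr0. Qed.

Let span_j x : span M' (fun f => 0 <= f 0 j) x -> laurent M'' x.
Proof. exact: (adj_laurent fM'' fM' adjj''). Qed.

Let laurent_w c : laurent M'' (1 + s ^ c * M' w).
Proof.
apply: span_j; rewrite -(frame0 fM').
by apply: spanD; [apply: spanM; rewrite mxE | apply: spanXM].
Qed.

(** Every further term is shifted by a positive multiple of w, and w_j >= 1 removes the simple pole
    in M'(e_j); if h_i = 0 there are no further terms. *)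
Let expand_pole h : h 0 j = -1 -> 0 <= h 0 i -> (0 < w 0 j \/ h 0 i = 0) ->
  exists2 y, M h = M' (refl i v h) + y & laurent M'' y.
Proof.
move=> hj hi w_h; have hn : h 0 i = (absz (h 0 i))%:Z by lia.
have [y e sy] := adj_expand fM' fM adji' hn.
exists y => //; apply: span_j; apply: span_sub sy => g [t /andP[t0 tn] ->].
rewrite rowDE rowZE refl_j hj; case: w_h => [wp|h0].
  by move: t0 wp; case: t {tn} => // t _; nia.
by move: t0 tn; rewrite h0; lia.
Qed.

(* The two exchange relations in direction j agree up to a monomial and terms
   that are polynomial in M'(e_j). *)
Lemma laurent_square_variable : laurent M'' (M2 (evec j)).
Proof.
have pj := adj_v adjj; have bj := adj_b adjj.
have pj' := adj_v adjj'; have bj' := adj_b adjj'.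
have hpbj : (p + b) 0 j = -1 by rewrite rowDE pj bj.
have wp1 : 0 < w 0 j \/ p 0 i = 0 by case: wj_pos => [|[]]; [left|right].
have wp2 : 0 < w 0 j \/ (p + b) 0 i = 0 by case: wj_pos => [|[]]; [left|right].
have [y1 e1 l1] := expand_pole _ pj p_ge0 wp1.
have [y2 e2 l2] := expand_pole _ hpbj pb_ge0 wp2.
rewrite (adj_new adjj) e1 e2 addrACA; apply: spanD; last exact: spanD.
pose u := refl i v p - p'.
have uj : u 0 j = 0 by rewrite /u !mxE refl_j pj pj' subrr.
rewrite reflD reflb; apply: (spanZV _ _ (bform L' u p')).
have -> : s ^ bform L' u p' * (M' (refl i v p) + M' (refl i v p + b')) =
    M'' u * M'' (evec j).
  rewrite (adj_new adjj') (adj_other adjj') // !mulrDr !(frameM fM').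
  have [d _ hd] := adj_compat adjj'.
  rewrite [bform L' u (_ + _)]bformDr (frame_alt fM' u b') hd uj mulr0 oppr0 addr0.
  by rewrite addrA /u subrK.
by apply: (laurentM fM''); exact: laurent_mono.
Qed.

(* The denominators in M' of the Laurent monomials in M. *)
Inductive denom : F -> Prop :=
| denom1 : denom 1
| denom_cons (c : int) D : denom D -> denom ((1 + s ^ c * M' w) * D).

(** The Ore condition for these denominators: passing M'(h) changes only the powers s^c. *)
Let denom_twist D h : denom D -> exists2 D', denom D' & D' * M' h = M' h * D.
Proof.
elim=> [|c E _ [E' dE' e]]; first by exists 1; [exact: denom1 | rewrite mul1r mulr1].
exists ((1 + s ^ (c - 2 * bform L' w h) * M' w) * E'); first exact: denom_cons.
rewrite -mulrA e !mulrA; congr (_ * _).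
rewrite mulrDl mulrDr mul1r mulr1; congr (_ + _).
by rewrite -mulrA (frameC fM' w) mulrA -scalarD subrK mulrA scalarC !mulrA.
Qed.

Let denomM D E : denom D -> denom E -> denom (D * E).
Proof.
move=> dD dE; elim: dD => [|c D' _ ih]; first by rewrite mul1r.
by rewrite -mulrA; apply: denom_cons.
Qed.

Let denom_comm_w D : denom D -> D * M' w = M' w * D.
Proof.
elim=> [|c E _ e]; first by rewrite mul1r mulr1.
by rewrite -mulrA e !mulrA; congr (_ * _); rewrite mulrDl mulrDr mul1r mulr1 mulrA -scalarC.
Qed.

Let denom_comm D E : denom D -> denom E -> D * E = E * D.
Proof.
move=> dD; elim=> [|c E' _ e]; first by rewrite mul1r mulr1.
rewrite mulrA -[RHS]mulrA -e mulrA; congr (_ * _).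
rewrite mulrDl mulrDr mul1r mulr1; congr (_ + _).
by rewrite mulrA -scalarC -!mulrA denom_comm_w.
Qed.

Let denom_laurent D : denom D -> laurent M'' D.
Proof.
elim=> [|c E _ lE]; first by rewrite -(frame0 fM''); apply: laurent_mono.
exact: (laurentM fM'').
Qed.

Let denom_inverse : exists c : int, (1 + s ^ c * M' w) * M (- evec i) = M' (- v).
Proof.
have [c e] : exists c : int, M (evec i) = (1 + s ^ c * M' w) * M' v.
  exists (- bform L' w v).
  by rewrite (adj_new adji') mulrDl mul1r -mulrA -(frame_add fM') (addrC w).
have dc : denom ((1 + s ^ c * M' w) * 1) by apply/denom_cons/denom1.
exists (c - 2 * bform L' w (- v)).
have tw : (1 + s ^ (c - 2 * bform L' w (- v)) * M' w) * M' (- v) =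
    M' (- v) * (1 + s ^ c * M' w).
  rewrite mulrDl mulrDr mul1r mulr1; congr (_ + _).
  by rewrite -mulrA (frameC fM' w) mulrA -scalarD subrK mulrA scalarC !mulrA.
apply: (mulIr (frame_unit fM (evec i))).
rewrite -mulrA (frameN_mul fM) mulr1 e mulrA -tw -mulrA (frameN_mul fM').
by rewrite mulr1.
Qed.

(** Each negative power of M(e_i) costs one factor, by [denom_inverse]. The j-th exponent never
    drops, since v_j = 0 and w_j >= 0. *)
Let clear_monomial g : exists2 D, denom D & span M' (fun f => g 0 j <= f 0 j) (D * M g).
Proof.
have [g0|g0] := leP 0 (g 0 i).
  exists 1; first exact: denom1.
  rewrite mul1r; apply: span_sub (adj_monomial fM' fM adji' g0).
  by move=> f [t ->]; rewrite rowDE rowZE refl_j; nia.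
have [n] : exists n : nat, g 0 i = - n%:Z by exists (absz (g 0 i)); lia.
elim: n g {g0} => [|n ih] g gi.
  exists 1; first exact: denom1.
  by rewrite mul1r -(adj_other adji) ?gi //; apply: spanM.
have [|D dD sD] := ih (g + evec i).
  by rewrite rowDE gi evecE eqxx; lia.
have [c ec] := denom_inverse.
have [D' dD' eD'] := denom_twist _ (- v) dD.
exists (D' * ((1 + s ^ c * M' w) * 1)).
  by apply: denomM => //; apply/denom_cons/denom1.
have -> : D' * ((1 + s ^ c * M' w) * 1) * M g =
    s ^ (- bform L (- evec i) (g + evec i)) * (M' (- v) * (D * M (g + evec i))).
  have -> : M g = s ^ (- bform L (- evec i) (g + evec i)) *
      (M (- evec i) * M (g + evec i)).
    by rewrite -(frame_add fM) addrC addrK.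
  rewrite mulr1 [LHS]mulrA -scalarC -!mulrA; congr (_ * _).
  by rewrite [X in D' * X]mulrA ec !mulrA eD'.
apply: spanZ; first exact: scalars_exp.
apply: (span_mul fM' _ _ _ _ _ _ (spanM M' (fun f => f 0 j = 0) _ _) sD) => [f f' fj|]; last by rewrite mxE vj oppr0.
by rewrite !rowDE fj add0r evecE (negPf ij) addr0.
Qed.

Let clearable x := exists2 D, denom D & laurent M'' (D * x).

Let clearableD x y : clearable x -> clearable y -> clearable (x + y).
Proof.
move=> [D dD lD] [E dE lE]; exists (D * E); first exact: denomM.
rewrite mulrDr {1}(denom_comm _ _ dD dE) -!mulrA.
by apply: spanD; apply: (laurentM fM'') => //; apply: denom_laurent.
Qed.

Let clearable_mono g : 0 <= g 0 j -> clearable (M g).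
Proof.
move=> gj; have [D dD sD] := clear_monomial g; exists D => //.
by apply: span_j; apply: span_sub sD => f; apply: le_trans.
Qed.

Let clearableMr x y : clearable x -> laurent M'' y -> clearable (x * y).
Proof.
move=> [D dD lD] ly; exists D => //; rewrite mulrA.
exact: (laurentM fM'').
Qed.

Let clearableZ a x : scalars a -> clearable x -> clearable (a * x).
Proof.
move=> sa [D dD lD]; exists D => //.
by rewrite mulrA -(scalars_central _ D sa) -mulrA; apply: spanZ.
Qed.

Let clearable0 : clearable 0.
Proof. by exists 1; [exact: denom1 | rewrite mulr0; exact: span0]. Qed.

(** Splitting in direction j leaves terms polynomial in M(e_j), which become polynomial in M'(e_j)
    once denominators are cleared, and terms polynomial in M2(e_j), which is itself Laurent in
    M''. *)
Lemma clearable_common x : laurent M x -> laurent M2 x -> clearable x.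
Proof.
move=> lx lx2; have [y [z [-> sy sz]]] := laurent_split fM fM2 adjj lx lx2.
apply: clearableD.
  apply: span_bind sy; [exact: clearable0|exact: clearableD|].
  by move=> a f sa f0; apply: clearableZ => //; apply: clearable_mono.
apply: span_bind sz; [exact: clearable0|exact: clearableD|].
move=> a f sa f0; apply: clearableZ => //.
rewrite (frame_rest _ _ j f fM2).
apply: clearableZ; first exact: scalars_exp.
have r0 : (f - f 0 j *: evec j) 0 j = 0 by rewrite !mxE !eqxx mulr1 subrr.
apply: clearableMr; first by rewrite (adj_other adjj) //; apply: clearable_mono; rewrite r0.
case: (f 0 j) f0 => // n _.
apply: (span_exp _ _ (fun _ => True) _ n fM'') => //.
exact: laurent_square_variable.
Qed.

Lemma laurent_square x : laurent M x -> laurent M' x -> laurent M2 x -> laurent M'' x.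
Proof.
move=> lx lx' lx2; have [D dD lD] := clearable_common _ lx lx2.
have [d d0 hd] := adj_compat adji'; have [d' d0' hd'] := adj_compat adjj'.
(* The factor -d makes phi(w) = d^2 positive; phi(b') = 0 because e_i has j-th coordinate 0. *)
pose phi f := - d * bform L' (evec i) f.
have phiD f g : phi (f + g) = phi f + phi g by rewrite /phi bformDr; ring.
have phib (t : nat) : phi (t%:Z *: b') = 0.
  rewrite /phi (frame_alt fM') bformZl hd' evecE (negPf ij) /=; ring.
have phiw : 0 < phi w.
  by rewrite /phi (frame_alt fM') hd evecE eqxx /=; nia.
elim: dD x lx' lD {lx lx2} => [|c E dE ih] x lx'; first by rewrite mul1r.
rewrite -mulrA => /(laurent_cancel _ _ _ _ _ _ _ fM' fM'' adjj' phi phiD phib w c _ wj phiw).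
move=> h; apply: ih => //; apply: h; apply: (laurentM fM') => //.
elim: dE => [|c' E' _ lE]; first by rewrite -(frame0 fM'); apply: laurent_mono.
apply: (laurentM fM') => //; rewrite -(frame0 fM').
by apply: spanD; [exact: laurent_mono|apply: spanXM].
Qed.

End Square.
Lemma adj_unique k v b M L M1 L1 M2 L2 : frame M1 L1 -> frame M2 L2 ->
  adj k v b M L M1 L1 -> adj k v b M L M2 L2 -> M1 =1 M2.
Proof.
move=> f1 f2 a1 a2 f; rewrite (frame_rest _ _ k f f1) (frame_rest _ _ k f f2).
have r0 : (f - f 0 k *: evec k) 0 k = 0 by rewrite !mxE !eqxx mulr1 subrr.
rewrite (adj_form a1) (adj_form a2) (adj_new a1) (adj_new a2).
by rewrite (adj_other a1 _ r0) (adj_other a2 _ r0).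
Qed.

Lemma laurent_eq M1 M2 x : M1 =1 M2 -> laurent M1 x -> laurent M2 x.
Proof.
move=> e; apply: span_bind; [exact: span0|exact: spanD|].
by move=> a f sa _; rewrite e; apply: spanZM.
Qed.

(** * The Laurent phenomenon *)

Section UpperBounds.
Variables (ex : {set 'I_N}) (d : 'I_N -> int).
Implicit Types B : 'M[int]_N.

(* Quantifying over all adjacent frames avoids choosing one: they are unique by
   adj_unique. *)
Definition upper M L B x := laurent M x /\
  forall k M' L', k \in ex -> frame M' L' ->
    adj k (exch_base B k) (exch B k) M L M' L' -> laurent M' x.

Lemma exch_adj_compat L B k : iseed ex d L B -> k \in ex ->
  exists2 c : int, c != 0 & forall g, bform L (exch B k) g = c * g 0 k.
Proof.
move=> sLB kex; exists (d k); first by rewrite gt_eqF // (iseed_pos _ _ _ _ sLB).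
by move=> g; rewrite (iseed_compat _ _ _ _ sLB).
Qed.

Lemma exists_adj M L B k : frame M L -> iseed ex d L B -> k \in ex ->
  exists M', frame M' (mutL k B L) /\
    adj k (exch_base B k) (exch B k) M L M' (mutL k B L).
Proof.
move=> fM sLB kex; exists (mutate k (exch_base B k) (exch B k) M L).
have vk := exch_base_k _ _ _ _ _ sLB kex; have bk := exch_k _ _ _ _ _ sLB kex.
have cp := exch_adj_compat _ _ _ sLB kex.
have fL f g := bform_mutL _ _ _ _ _ f g sLB kex.
by split; [apply: mutate_frame | apply: mutate_adj].
Qed.

Lemma adj_mut_back M L M' B k : frame M L -> iseed ex d L B -> k \in ex ->
  frame M' (mutL k B L) -> adj k (exch_base B k) (exch B k) M L M' (mutL k B L) ->
  adj k (exch_base (mutB k B) k) (exch (mutB k B) k) M' (mutL k B L) M L.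
Proof.
move=> fM sLB kex fM' a; rewrite exch_base_mutB_k exch_mutB_k.
by apply: adj_flip (frame_alt fM') _; apply: adj_sym.
Qed.

(** For j = k the neighbour M2 is M' by uniqueness. Otherwise [laurent_square] is applied to the
    path M'' - M' - M - M2, with the roles of M and M' exchanged. The sign of b_jk selects the
    orientation in direction k for which v_j = 0 and w_j >= 0. *)
Lemma upper_mut M L M' B k x : frame M L -> iseed ex d L B -> k \in ex ->
  frame M' (mutL k B L) -> adj k (exch_base B k) (exch B k) M L M' (mutL k B L) ->
  upper M' (mutL k B L) (mutB k B) x -> upper M L B x.
Proof.
move=> fM sLB kex fM' a [lx' ux'].
have lx : laurent M x := ux' k M L kex fM (adj_mut_back _ _ _ _ _ fM sLB kex fM' a).
split=> // j M2 L2 jex fM2 a2.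
have [ejk|jk] := eqVneq j k.
  by rewrite ejk in a2; apply: laurent_eq lx'; exact: adj_unique fM' fM2 a a2.
have sLB' := iseed_mut _ _ _ _ _ sLB kex.
have [M'' [fM'' a'']] := exists_adj _ _ _ j fM' sLB' jex.
have lx'' := ux' j M'' _ jex fM'' a''.
set B' := mutB k B in sLB' a'' lx''.
have kj : k != j by rewrite eq_sym.
have B'kj : B' k j = - B k j by rewrite mxE eqxx.
have p0 : 0 <= exch_base B' j 0 k.
  by rewrite exch_baseE (negPf jk) /Num.min; case: ltP; lia.
have pb0 : 0 <= (exch_base B' j + exch B' j) 0 k.
  by rewrite -exch_base_bpos rowDE mxE evecE (negPf jk) mxE /Num.max; case: ltP; lia.
have v_j : exch_base B k 0 j = - Num.min (B j k) 0.
  by rewrite exch_baseE (negPf kj) oppr0 add0r.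
have sgn := iseed_sign _ _ _ _ k j sLB kex jex.
have vk := exch_base_k _ _ _ _ _ sLB kex; have bk := exch_k _ _ _ _ _ sLB kex.
have a' := adj_sym fM fM' a.
have [Bjk|Bjk] := leP 0 (B j k).
  apply: (laurent_square _ _ _ _ _ _ _ _ _ _ _ _ _ _ _ _ fM' fM fM'' fM2 a' a'' a2
    kj) => //.
  - by rewrite v_j min_r.
  - by rewrite exchE.
  - by rewrite (exch_mutB_le0 _ _ _ _ _ _ sLB) // ?reflK // -sgn.
  - rewrite exchE; case: (ltgtP (B j k) 0) Bjk => // [|B0] _; [by left|right].
    have Bkj : B k j = 0.
      have := iseed_skew _ _ _ _ _ _ sLB kex jex; rewrite B0 mulr0 oppr0.
      by have := iseed_pos _ _ _ _ sLB _ kex; nia.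
    split; first by rewrite exch_baseE (negPf jk) B'kj Bkj.
    by rewrite -exch_base_bpos rowDE mxE evecE (negPf jk) mxE B'kj Bkj.
have Bkj : 0 <= B k j by rewrite ltW // ltNge -sgn -ltNge.
have a'f := adj_flip _ _ _ _ _ _ _ (frame_alt fM') a'.
apply: (laurent_square _ _ _ _ _ _ _ _ _ _ _ _ _ _ _ _ fM' fM fM'' fM2 a'f a'' a2
  kj) => //.
- by rewrite rowDE v_j exchE min_l ?ltW // addNr.
- by rewrite mxE exchE oppr_ge0 ltW.
- by rewrite (exch_mutB_ge0 _ _ _ _ _ _ sLB) // reflK // rowDE vk bk.
- by left; rewrite mxE exchE oppr_gt0.
Qed.

Lemma upper_variable M L B i : frame M L -> iseed ex d L B -> upper M L B (M (evec i)).
Proof.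
move=> fM sLB; split; first exact: laurent_mono.
move=> k M' L' kex fM' a; have [->|ik] := eqVneq i k.
  by rewrite (adj_new (adj_sym fM fM' a)); apply: spanD; exact: laurent_mono.
by rewrite -(adj_other a) ?evecE ?(negPf ik) //; exact: laurent_mono.
Qed.

End UpperBounds.

(** * Toric frames with a chosen integer lift of their matrix *)

Section ToricFrames.
Variables (m : nat) (ex : {set 'I_N}) (d : 'I_N -> int).
(* m is the multiplicative order of s, and 0 when s has infinite order. *)
Hypothesis order : forall a b : int, congz m a b <-> s ^ a = s ^ b.
Implicit Types B : 'M[int]_N.

Lemma scalar_bform L L' f g : (forall i j, s ^ L i j = s ^ L' i j) ->
  s ^ bform L f g = s ^ bform L' f g.
Proof.
move=> e; rewrite !bform_sum.
pose eqs (x y : int) := s ^ x = s ^ y; rewrite -/(eqs _ _).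
have eqsD (x1 x2 y1 y2 : int) : eqs x1 x2 -> eqs y1 y2 -> eqs (x1 + y1) (x2 + y2).
  by rewrite /eqs !scalarD => -> ->.
apply: (big_ind2 eqs) => // i _; apply: (big_ind2 eqs) => // j _; rewrite /eqs.
by rewrite ![f 0 i * _]mulrC -!mulrA -!exprz_exp e.
Qed.

Lemma toric_frame_frame M L : alternating L -> toric_frame m s M L -> frame M L.
Proof.
move=> altL [_ M0 MM Mfree _]; split=> //.
move=> a f x [r ->] sx; have [c [uc fc ->]] : exists c : seq (seq (int * int) * 'rV[int]_N),
    [/\ uniq (map snd c), f \notin map snd c & x = \sum_(p <- c) lev s p.1 * M p.2].
  elim: sx => [|b g z [r' ->] gf _ [c [uc fc ->]]].
    by exists [::]; rewrite big_nil.
  have [gc|gc] := boolP (g \in map snd c); last first.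
    exists ((r', g) :: c); rewrite /= gc uc big_cons; split=> //.
    by rewrite inE negb_or fc andbT; apply/eqP=> e; apply: gf.
  have [q qc eg] := mapP gc.
  have pc := perm_to_rem qc.
  have um : perm_eq (map snd c) (g :: map snd (rem q c)).
    by rewrite eg; exact: (perm_map snd pc).
  exists ((r' ++ q.1, g) :: rem q c); split.
  - by have := uc; rewrite (perm_uniq um).
  - by have := fc; rewrite (perm_mem um).
  - by rewrite (perm_big _ pc) !big_cons /= addrA /lev big_cat mulrDl eg.
move=> e0; apply: (Mfree ((r, f) :: c) _ _ (r, f)); rewrite ?mem_head //=.
  by rewrite fc.
by rewrite big_cons.
Qed.

Definition frame_gens M x := x = s \/ exists f, x = M f.

Lemma frame_toric_frame M L : frame M L -> skew_generates (frame_gens M) ->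
  toric_frame m s M L.
Proof.
move=> fM gM; split=> //; [|exact: frame0 fM|exact: frameM fM|].
  move=> i j; apply/order; congr (s ^ _).
  by rewrite -!bform_evec (frame_alt fM).
move=> c uc e0 p pc; have pc' := perm_to_rem pc.
apply: (frame_free fM _ p.2 (\sum_(q <- rem p c) lev s q.1 * M q.2)).
- by exists p.1.
- rewrite big_seq; apply: big_ind; [exact: span0|exact: spanD|].
  move=> q qc; apply: spanZM; first by exists q.1.
  move=> e; move: uc; rewrite (perm_uniq (perm_map _ pc')) /= -e.
  by rewrite (map_f snd qc).
- by rewrite -[RHS]e0 (perm_big _ pc') big_cons.
Qed.

Lemma toric_frame_congr M L L' : alternating L' -> (forall i j, s ^ L i j = s ^ L' i j) ->
  toric_frame m s M L -> toric_frame m s M L'.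
Proof.
move=> altL' e [_ M0 MM Mfree gM]; split=> //.
  by move=> i j; apply/order; congr (s ^ _); rewrite -!bform_evec altL'.
by move=> f g; rewrite MM (scalar_bform _ _ f g e).
Qed.

Lemma toric_frame_form M L L' : frame M L -> toric_frame m s M L' ->
  forall i j, s ^ L' i j = s ^ L i j.
Proof.
move=> fM [_ _ MM _ _] i j; have := MM (evec i) (evec j).
by rewrite (frameM fM) !bform_evec => /(mulIr (frame_unit fM _)).
Qed.

Lemma adj_generates k v b M L M' L' : frame M L -> frame M' L' ->
  adj k v b M L M' L' -> skew_generates (frame_gens M) -> skew_generates (frame_gens M').
Proof.
move=> fM fM' a gM S S1 SB SM SV SX.
have S0 : S 0 by rewrite -(subrr 1); apply: SB.
have SN x : S x -> S (- x) by rewrite -sub0r; apply: SB.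
have SD x y : S x -> S y -> S (x + y).
  by move=> Sx Sy; rewrite -[y]opprK; apply: SB => //; apply: SN.
have SV' x : S x -> S x^-1.
  by have [->|x0] := eqVneq x 0; [rewrite invr0|move=> Sx; apply: SV].
have SXn x (n : int) : S x -> S (x ^ n).
  move=> Sx; have Sn t : S (x ^+ t).
    by elim: t => [|t ih]; rewrite ?expr0 // exprS; apply: SM.
  by case: n => n; [apply: Sn | rewrite NegzE -exprnN; apply/SV'/Sn].
have Ss : S s by apply: SX; left.
have SM' f : S (M' f) by apply: SX; right; exists f.
apply: gM => // x [->//|[f ->]]; rewrite (frame_rest _ _ k f fM).
have r0 : (f - f 0 k *: evec k) 0 k = 0 by rewrite !mxE !eqxx mulr1 subrr.
apply: (SM); first exact: SXn.
apply: (SM); first by rewrite -(adj_other a _ r0).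
by apply: SXn; rewrite (adj_new (adj_sym fM fM' a)); apply: SD.
Qed.

Lemma frame_extend M L M' L' k : frame M L -> frame M' L' ->
  (forall f g, f 0 k = 0 -> g 0 k = 0 -> bform L' f g = bform L f g) ->
  (forall j, j != k -> M' (evec j) = M (evec j)) -> forall f, f 0 k = 0 -> M' f = M f.
Proof.
move=> fM fM' eL eM f fk; rewrite (row_evec f).
suff [] : (\sum_i f 0 i *: evec i) 0 k = 0 /\
  M' (\sum_i f 0 i *: evec i) = M (\sum_i f 0 i *: evec i) by [].
elim/big_ind: _ => [|g h [g0 eg] [h0 eh]|i _].
- by rewrite mxE (frame0 fM) (frame0 fM').
- by rewrite rowDE g0 h0 (frame_add fM) (frame_add fM') eL // eg eh.
- have [->|ik] := eqVneq i k.
    by rewrite fk scale0r mxE (frame0 fM) (frame0 fM').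
  by rewrite rowZE evecE (negPf ik) mulr0 -(frame_exp fM) -(frame_exp fM') eM.
Qed.

(** The matrices hidden in [mut_frame] are determined only mod m. Powers of s do not see the
    difference, so the chosen lift L can be propagated as [mutL k B L]. *)
Lemma toric_mut_frame M L B M' k : toric_frame m s M L -> iseed ex d L B -> k \in ex ->
  mut_frame m s k B M M' ->
  toric_frame m s M' (mutL k B L) /\ adj k (exch_base B k) (exch B k) M L M' (mutL k B L).
Proof.
move=> tM sLB kex [L1 [L1' [tM1 tM1' cL nM new]]].
have fM := toric_frame_frame _ _ (iseed_alt _ _ _ _ sLB) tM.
have sLB' := iseed_mut _ _ _ _ _ sLB kex.
have tM' : toric_frame m s M' (mutL k B L).
  apply: toric_frame_congr (iseed_alt _ _ _ _ sLB') _ tM1' => i j.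
  move/order: (cL i j) => ->; rewrite -!bform_evec.
  have eE X f g : bform ((mutE k B)^T *m X *m mutE k B) f g =
      bform X (f *m (mutE k B)^T) (g *m (mutE k B)^T).
    by rewrite /bform trmx_mul trmxK !mulmxA.
  rewrite /mutL !eE; apply: scalar_bform.
  exact: toric_frame_form fM tM1.
have fM' := toric_frame_frame _ _ (iseed_alt _ _ _ _ sLB') tM'.
split=> //; split.
- exact: exch_base_k sLB kex.
- exact: exch_k sLB kex.
- exact: exch_adj_compat sLB kex.
- by move=> f g; apply: bform_mutL sLB kex.
- apply: frame_extend fM fM' _ nM => f g f0 g0.
  by rewrite (bform_mutL _ _ _ _ _ _ _ sLB kex) !refl_id.
- by rewrite new exch_base_bpos addrC.
Qed.

Lemma exists_mut_frame M L B k : toric_frame m s M L -> iseed ex d L B -> k \in ex ->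
  exists M', mut_frame m s k B M M'.
Proof.
move=> tM sLB kex; have fM := toric_frame_frame _ _ (iseed_alt _ _ _ _ sLB) tM.
have [M' [fM' a]] := exists_adj _ _ _ _ _ _ fM sLB kex.
have gM : skew_generates (frame_gens M) by case: tM.
exists M', L, (mutL k B L); split=> //.
- by apply: (frame_toric_frame _ _ fM'); apply: adj_generates fM fM' a gM.
- by move=> i j; apply/order.
- by move=> j jk; rewrite (adj_other a) // evecE (negPf jk).
- by rewrite (adj_new a) exch_base_bpos addrC.
Qed.

Lemma laurent_phenomenon M0 L0 B0 M B : toric_frame m s M0 L0 -> iseed ex d L0 B0 ->
  mut_equiv m s ex M0 B0 M B -> forall i, laurent M0 (M (evec i)).
Proof.
move=> tM0 sLB0 eM i.
have [L [tM sLB uM]] : exists L, [/\ toric_frame m s M L, iseed ex d L B &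
    forall x, upper ex M L B x -> laurent M0 x].
  elim: eM => [|M1 B1 M' k _ [L [tM sLB uM]] kex mM].
    by exists L0; split=> // x [].
  have [tM' a] := toric_mut_frame _ _ _ _ _ tM sLB kex mM.
  have sLB' := iseed_mut _ _ _ _ _ sLB kex.
  exists (mutL k B1 L); split=> // x ux; apply: uM.
  apply: (upper_mut _ _ _ _ _ _ _ _ _ sLB kex _ a ux).
  - exact: toric_frame_frame (iseed_alt _ _ _ _ sLB) tM.
  - exact: toric_frame_frame (iseed_alt _ _ _ _ sLB') tM'.
apply: uM; apply: (upper_variable _ _ _ _ _ _ _ sLB).
exact: toric_frame_frame (iseed_alt _ _ _ _ sLB) tM.
Qed.

End ToricFrames.
End Adjacency.

End Frames.

(** * Specialization *)

Section ScalarOrders.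
Implicit Types (F : unitRingType) (c : seq (int * int)).

Lemma congz0 (a b : int) : congz 0 a b <-> a = b.
Proof. by rewrite /congz !modz0; split=> [/eqP|->]. Qed.

Lemma exprz_eq1 F (s : F) (c : int) : (s ^ c == 1) = (s ^+ `|c|%N == 1).
Proof.
case: c => n //; rewrite NegzE abszN -exprnN.
by rewrite -[1 in LHS]invr1 (inj_eq invr_inj).
Qed.

Lemma exprz_eq F (s : F) (a b : int) : s \is a GRing.unit ->
  (s ^ a == s ^ b) = (s ^+ `|a - b|%N == 1).
Proof.
move=> us; rewrite -exprz_eq1 -{1}[a](subrK b) exprzDr // -{2}[s ^ b]mul1r.
exact: (inj_eq (mulIr (unitrXz b us))).
Qed.

Lemma transcendental_neq0 F (t : F) : transcendental t -> t != 0.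
Proof. by move/(_ 'X (monic_neq0 (monicX _))); rewrite map_polyX hornerX. Qed.

Lemma transcendental_order F (t : F) : division_ring F -> transcendental t ->
  forall a b : int, congz 0 a b <-> t ^ a = t ^ b.
Proof.
move=> divF trt a b; have ut := divF _ (transcendental_neq0 _ _ trt).
rewrite congz0; split=> [-> //|/eqP]; rewrite exprz_eq // => /eqP tn.
apply/eqP; rewrite -subr_eq0 -absz_eq0; apply: contraT; rewrite -lt0n => n0.
have /trt : ('X^`|a - b|%N - 1 : {poly int}) != 0.
  by rewrite -size_poly_eq0 size_XnsubC.
by rewrite rmorphB /= map_polyXn rmorph1 !hornerE /= ?hornerXn tn subrr eqxx.
Qed.

Lemma primitive_root_neq0 F (e : F) l : l.-primitive_root e -> e != 0.
Proof.
move=> pe; apply/eqP => e0; have := prim_expr_order pe.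
rewrite e0 expr0n gtn_eqF ?(prim_order_gt0 pe) // => /esym /eqP.
by rewrite oner_eq0.
Qed.

Lemma primitive_order F (e : F) l : division_ring F -> l.-primitive_root e ->
  forall a b : int, congz l a b <-> e ^ a = e ^ b.
Proof.
move=> divF pe a b; have ue := divF _ (primitive_root_neq0 _ _ _ pe).
rewrite /congz eqz_mod_dvd; split.
  by rewrite dvdzE /= (prim_order_dvd pe) -exprz_eq // => /eqP.
by move/eqP; rewrite exprz_eq // -(prim_order_dvd pe) dvdzE.
Qed.

(** The order of quantifiers is the point: one polynomial serves all rings and scalars, so a
    relation at t can be transported to e. *)
Lemma lev_poly c : exists n (p : {poly int}), forall F (s : F), s \is a GRing.unit ->
  (map_poly (fun z : int => z%:~R : F) p).[s] = lev s c * s ^+ n.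
Proof.
elim: c => [|[z a] c [n [p hp]]].
  by exists 0%N, 0 => F s us; rewrite rmorph0 horner0 /lev big_nil mul0r.
pose m := `|a|%N.
exists (n + m)%N, (z%:P * 'X^(`|a + n%:Z + m%:Z|) + p * 'X^m) => F s us.
have hornerMXn (q : {poly F}) i : (q * 'X^i).[s] = q.[s] * s ^+ i.
  by rewrite hornerM_comm ?hornerXn //; apply/comm_poly_exp/comm_polyX.
rewrite rmorphD !rmorphM /= !map_polyXn map_polyC /= hornerD !hornerMXn hornerC hp //.
rewrite /lev big_cons /= mulrDl; congr (_ + _); last by rewrite exprD mulrA.
rewrite -mulrA; congr (_ * _); rewrite !exprnP -exprzDr //; congr (s ^ _).
by rewrite /m; lia.
Qed.

Lemma lev_specialize F F' (t : F) (s : F') c : division_ring F -> transcendental t ->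
  s \is a GRing.unit -> lev t c = 0 -> lev s c = 0.
Proof.
move=> divF trt us t0; have [n [p hp]] := lev_poly c.
have ut := divF _ (transcendental_neq0 _ _ trt).
have [p0|/trt] := eqVneq p 0; last by rewrite hp // t0 mul0r eqxx.
by apply: (mulIr (unitrX n us)); rewrite -hp // p0 rmorph0 horner0 mul0r.
Qed.

End ScalarOrders.

Arguments frameM {N F s M L}.
Arguments frame0 {N F s M L}.
Arguments frame_alt {N F s M L}.
Arguments frame_free {N F s M L}.
Arguments frame_unit {N F s M L}.
Arguments frame_exp {N F s M L}.
Arguments frameV {N F s M L}.
Arguments adj_other {N F k v b M L M' L'}.
Arguments adj_new {N F k v b M L M' L'}.
Arguments laurent {N F}.

(** * The specialization map as a multiplicative graph *)

Section Specialization.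
Context {N : nat} {Fq F : unitRingType} (t : Fq) (e : F).
Hypotheses (divq : division_ring Fq) (div : division_ring F)
  (ct : central t) (ce : central e) (t0 : t != 0) (e0 : e != 0).
Hypothesis lev0 : forall c, lev t c = 0 -> lev e c = 0.
Variables (Mq : 'rV[int]_N -> Fq) (M : 'rV[int]_N -> F) (L : 'M[int]_N).
Hypotheses (fq : frame t Mq L) (fe : frame e M L).
Implicit Types (x : Fq) (y : F) (f g : 'rV[int]_N).

Let spec := spec_rel t Mq e M.

(** This is what makes the graph single-valued: after collecting one exponent, its coefficient
    vanishes at t by independence, hence at e by [lev0]. *)
Let spec_zero (c : seq (int * int * 'rV[int]_N)) :
  \sum_(p <- c) p.1.1%:~R * t ^ p.1.2 * Mq p.2 = 0 ->
  \sum_(p <- c) p.1.1%:~R * e ^ p.1.2 * M p.2 = 0.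
Proof.
have [n] := ubnP (size c); elim: n c => // n ih [|p c] sc.
  by rewrite !big_nil.
pose r := [seq q.1 | q <- p :: c & q.2 == p.2].
pose c' := [seq q <- p :: c | q.2 != p.2].
have sumE (F' : unitRingType) (s : F') (M' : 'rV[int]_N -> F') :
    \sum_(q <- p :: c) q.1.1%:~R * s ^ q.1.2 * M' q.2 =
    lev s r * M' p.2 + \sum_(q <- c') q.1.1%:~R * s ^ q.1.2 * M' q.2.
  rewrite (bigID (fun q => q.2 == p.2)) /= big_filter /lev big_map big_filter.
  by congr (_ + _); rewrite mulr_suml; apply: eq_bigr => q /eqP ->.
rewrite !sumE => h; have r0 : lev t r = 0.
  apply: (frame_free fq _ _ _ _ _ h); first by exists r.
  rewrite big_seq; apply: big_ind; [exact: span0|exact: spanD|].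
  move=> q; rewrite mem_filter => /andP[/eqP qp _].
  by apply: spanZM => //; exact: scalarsX.
rewrite (lev0 _ r0) mul0r add0r; apply: ih.
  rewrite /c' /= eqxx /= size_filter; apply: leq_ltn_trans (count_size _ _) _.
  by rewrite -ltnS.
by move: h; rewrite r0 mul0r add0r.
Qed.

Lemma spec_relB x y x' y' : spec x y -> spec x' y' -> spec (x - x') (y - y').
Proof.
move=> [c [-> ->]] [c' [-> ->]].
exists (c ++ [seq (- p.1.1, p.1.2, p.2) | p <- c']).
rewrite !big_cat !big_map /=; split; congr (_ + _);
  by rewrite -sumrN; apply: eq_bigr => p _; rewrite mulrNz !mulNr.
Qed.

Lemma spec_rel_unique x y y' : spec x y -> spec x y' -> y = y'.
Proof.
move=> h h'; have [c [ex ey]] := spec_relB _ _ _ _ h h'.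
apply/eqP; rewrite -subr_eq0 ey; apply/eqP/spec_zero.
by rewrite -ex subrr.
Qed.

Let term_mul (F' : unitRingType) (s : F') (M' : 'rV[int]_N -> F') (n n' a a' : int) f g :
  division_ring F' -> central s -> s != 0 -> frame s M' L ->
  (n%:~R * s ^ a * M' f) * (n'%:~R * s ^ a' * M' g) =
  (n * n')%:~R * s ^ (a + a' + bform L f g) * M' (f + g).
Proof.
move=> divF cs s0 fM; rewrite -!(mulrA _%:~R) -(monoM s divF cs s0 fM).
by rewrite intrM -(mulrA n%:~R n'%:~R); congr (_ * _); rewrite [LHS]mulrA (commr_int _ n') -mulrA.
Qed.

Lemma spec_relM x y x' y' : spec x y -> spec x' y' -> spec (x * x') (y * y').
Proof.
move=> [c [-> ->]] [c' [-> ->]].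
exists [seq (p.1.1 * q.1.1, p.1.2 + q.1.2 + bform L p.2 q.2, p.2 + q.2) | p <- c, q <- c'].
by split; rewrite big_allpairs_dep /= mulr_suml; apply: eq_bigr => p _;
  rewrite mulr_sumr; apply: eq_bigr => q _ /=; rewrite term_mul.
Qed.

Lemma spec_rel_term (a : int) f : spec (t ^ a * Mq f) (e ^ a * M f).
Proof. by exists [:: (1, a, f)]; rewrite !big_seq1 /= !mul1r. Qed.

Lemma spec_rel_scalar (a : int) : spec (t ^ a) (e ^ a).
Proof.
by have := spec_rel_term a 0; rewrite (frame0 fq) (frame0 fe) !mulr1.
Qed.

Lemma spec_rel_mono f : spec (Mq f) (M f).
Proof. by have := spec_rel_term 0 f; rewrite !mul1r. Qed.

Lemma spec_rel1 : spec 1 1.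
Proof. exact: (spec_rel_scalar 0). Qed.

Lemma spec_relD x y x' y' : spec x y -> spec x' y' -> spec (x + x') (y + y').
Proof.
move=> h h'; rewrite -[x']opprK -[y']opprK; apply: spec_relB => //.
rewrite -[- x']sub0r -[- y']sub0r; apply: spec_relB => //.
by rewrite -(subrr 1) -[X in spec _ X](subrr 1); apply: spec_relB; exact: spec_rel1.
Qed.

Lemma laurent_spec_rel x : laurent t Mq x -> exists y, spec x y.
Proof.
apply: (span_bind _ _ _ (fun x' => exists y, spec x' y)) => [|x1 x2 [y1 h1] [y2 h2]|a f [r ->] _].
- by exists (1 - 1); rewrite -(subrr 1); apply: spec_relB; exact: spec_rel1.
- by exists (y1 + y2); exact: spec_relD.
- exists (lev e r * M f), [seq (p, f) | p <- r].
  by rewrite !big_map /= /lev !mulr_suml.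
Qed.

Section Mutation.
Variables (k : 'I_N) (v b : 'rV[int]_N).
Variables (Mq1 Mq2 : 'rV[int]_N -> Fq) (M1 M2 : 'rV[int]_N -> F) (L1 L2 : 'M[int]_N).
Hypotheses (fq1 : frame t Mq1 L1) (fe1 : frame e M1 L1).
Hypotheses (aq : adj k v b Mq1 L1 Mq2 L2) (ae : adj k v b M1 L1 M2 L2).
Hypothesis spec1 : forall i, spec (Mq1 (evec i)) (M1 (evec i)).
Hypothesis v_ge0 : forall i, 0 <= (v + evec k) 0 i.
Hypothesis vb_ge0 : forall i, 0 <= (v + b + evec k) 0 i.
Hypothesis laurent2 : laurent t Mq (Mq2 (evec k)).

(** Inverses of the variables of Mq1 need not be Laurent in Mq, so the specialization is controlled
    on nonnegative exponents only. The exchange relation is multiplied by the old variable to reach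
    this range. *)
Let spec_ge0 f : (forall i, 0 <= f 0 i) -> spec (Mq1 f) (M1 f).
Proof.
move=> f0; rewrite (row_evec f).
elim/big_ind: _ => [|g h sg sh|i _].
- by rewrite (frame0 fq1) (frame0 fe1); exact: spec_rel1.
- rewrite (frame_add t divq t0 fq1) (frame_add e div e0 fe1).
  by apply: spec_relM; [exact: spec_rel_scalar | exact: spec_relM].
- rewrite -(frame_exp fq1) -(frame_exp fe1).
  case: (f 0 i) (f0 i) => // n _; elim: n => [|n ih]; first exact: spec_rel1.
  by rewrite -!exprnP !exprS; apply: spec_relM.
Qed.

(* kappa(x_k') kappa(x_k) is the image of the exchange polynomial, and
   kappa(x_k) = M1(e_k) can be cancelled. *)
Lemma spec_rel_mutation i : spec (Mq2 (evec i)) (M2 (evec i)).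
Proof.
have [->|ik] := eqVneq i k; last first.
  have z : evec i 0 k = 0 by rewrite evecE (negPf ik).
  by rewrite (adj_other aq _ z) (adj_other ae _ z).
have [y sy] := laurent_spec_rel _ laurent2.
suff <- : y = M2 (evec k) by [].
apply: (mulIr (frame_unit fe1 (evec k))).
apply: (spec_rel_unique (Mq2 (evec k) * Mq1 (evec k))).
  exact: spec_relM.
rewrite (adj_new aq) (adj_new ae) !mulrDl !(frameM fq1) !(frameM fe1).
by apply: spec_relD; apply: spec_relM; (exact: spec_rel_scalar || exact: spec_ge0).
Qed.

End Mutation.
End Specialization.

Lemma compatible_iseed N (ex : {set 'I_N}) (d : 'I_N -> int) (L B : 'M[int]_N) :
  (forall i j, L i j = - L j i) -> compatible 0 ex d L B -> iseed ex d L B.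
Proof.
move=> skL [d0 _ cLB]; split=> //; first exact: alternating_skew.
move=> j g jex; rewrite bform_sum exchange_big /=.
rewrite (bigD1 j) //= -[RHS]addr0; congr (_ + _).
  rewrite -mulr_suml; congr (_ * _); move/congz0: (cLB j j jex); rewrite eqxx => <-.
  by apply: eq_bigr => k _; rewrite exchE.
apply: big1 => i ij; rewrite -mulr_suml; move/congz0: (cLB i j jex).
rewrite (negPf ij) => e; under eq_bigr => k _ do rewrite exchE.
by rewrite e mul0r.
Qed.

Section AlgebraGenerated.
Context {F : unitRingType} (s : F) (X : F -> Prop).

Lemma alg_gen_mem x : X x -> alg_gen s X x.
Proof. by move=> Xx S _ _ _ _ _; apply. Qed.

Lemma alg_gen1 : alg_gen s X 1.
Proof. by move=> S. Qed.

Lemma alg_gen_scalar : alg_gen s X s.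
Proof. by move=> S. Qed.

Lemma alg_gen_scalarV : alg_gen s X s^-1.
Proof. by move=> S. Qed.

Lemma alg_genB x y : alg_gen s X x -> alg_gen s X y -> alg_gen s X (x - y).
Proof.
move=> gx gy S S1 SB SM Ss SV SX.
by apply: (SB); [apply: gx | apply: gy].
Qed.

Lemma alg_genM x y : alg_gen s X x -> alg_gen s X y -> alg_gen s X (x * y).
Proof.
move=> gx gy S S1 SB SM Ss SV SX.
by apply: (SM); [apply: gx | apply: gy].
Qed.

End AlgebraGenerated.

(** * Matching the two mutation classes *)

Section ClusterAlgebras.
Context {N : nat} (l : nat) (ex : {set 'I_N}) (d : 'I_N -> int) (B0 L0 : 'M[int]_N).
Context {Fq F : unitRingType} (t : Fq) (e : F).
Variables (Mq : 'rV[int]_N -> Fq) (M : 'rV[int]_N -> F).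
Hypotheses (divq : division_ring Fq) (div : division_ring F)
  (ct : central t) (ce : central e) (trt : transcendental t) (pe : l.-primitive_root e).
Hypotheses (tq : toric_frame 0 t Mq L0) (te : toric_frame l e M L0).
Hypothesis sLB0 : iseed ex d L0 B0.

Let t0 : t != 0 := transcendental_neq0 _ _ trt.
Let e0 : e != 0 := primitive_root_neq0 _ _ _ pe.
Let ordq := transcendental_order _ _ divq trt.
Let orde := primitive_order _ _ _ div pe.
Let lev0 c (h : lev t c = 0) : lev e c = 0 := lev_specialize _ _ _ _ _ divq trt (div _ e0) h.
Let fq := toric_frame_frame _ _ _ _ (iseed_alt _ _ _ _ sLB0) tq.
Let fe := toric_frame_frame _ _ _ _ (iseed_alt _ _ _ _ sLB0) te.
Let spec := spec_rel t Mq e M.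

(** A single integer matrix serves both frames: strictness persists along mutations. *)
Definition specialized_seed Mq' M' B' := exists L', [/\ toric_frame 0 t Mq' L',
  toric_frame l e M' L', iseed ex d L' B' &
  forall i, spec (Mq' (evec i)) (M' (evec i))].

Lemma specialized_seed_mut Mq1 M1 B1 Mq2 M2 k : specialized_seed Mq1 M1 B1 ->
  mut_equiv 0 t ex Mq B0 Mq1 B1 -> k \in ex ->
  mut_frame 0 t k B1 Mq1 Mq2 -> mut_frame l e k B1 M1 M2 ->
  specialized_seed Mq2 M2 (mutB k B1).
Proof.
move=> [L1 [tq1 te1 sLB1 sp1]] eq1 kex mq me.
have [tq2 aq] := toric_mut_frame _ divq t0 _ _ _ ordq _ _ _ _ _ tq1 sLB1 kex mq.
have [te2 ae] := toric_mut_frame _ div e0 _ _ _ orde _ _ _ _ _ te1 sLB1 kex me.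
exists (mutL k B1 L1); split=> //; first exact: iseed_mut.
have alt1 := iseed_alt _ _ _ _ sLB1.
apply: (spec_rel_mutation _ _ divq div ct ce t0 e0 lev0 _ _ _ fq fe _ _ _ _ _ _ _ _ _
  (toric_frame_frame _ _ _ _ alt1 tq1) (toric_frame_frame _ _ _ _ alt1 te1) aq ae sp1).
- move=> i; rewrite rowDE exch_baseE evecE /Num.min.
  by case: ltP; lia.
- move=> i; rewrite -exch_base_bpos !rowDE [(- evec k) 0 i]mxE evecE mxE /Num.max.
  by case: ltP; lia.
- have eq2 := mut_equiv_step eq1 kex mq.
  exact: (laurent_phenomenon _ divq ct t0 _ _ _ ordq _ _ _ _ _ tq sLB0 eq2).
Qed.

Let specialized_seed0 : specialized_seed Mq M B0.
Proof. by exists L0; split=> // i; apply: spec_rel_mono. Qed.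

Lemma specialize_mut_equiv Mq' B' : mut_equiv 0 t ex Mq B0 Mq' B' ->
  exists2 M', mut_equiv l e ex M B0 M' B' & specialized_seed Mq' M' B'.
Proof.
elim=> [|Mq1 B1 Mq2 k eq1 [M1 e1 sp1] kex mq].
  by exists M; [exact: mut_equiv_refl | exact: specialized_seed0].
have [L1 [_ te1 sLB1 _]] := sp1.
have [M2 me] := exists_mut_frame _ div ce e0 _ _ _ orde _ _ _ _ te1 sLB1 kex.
exists M2; first exact: mut_equiv_step e1 kex me.
exact: specialized_seed_mut sp1 eq1 kex mq me.
Qed.

Lemma lift_mut_equiv M' B' : mut_equiv l e ex M B0 M' B' ->
  exists2 Mq', mut_equiv 0 t ex Mq B0 Mq' B' & specialized_seed Mq' M' B'.
Proof.
elim=> [|M1 B1 M2 k _ [Mq1 eq1 sp1] kex me].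
  by exists Mq; [exact: mut_equiv_refl | exact: specialized_seed0].
have [L1 [tq1 _ sLB1 _]] := sp1.
have [Mq2 mq] := exists_mut_frame _ divq ct t0 _ _ _ ordq _ _ _ _ tq1 sLB1 kex.
exists Mq2; first exact: mut_equiv_step eq1 kex mq.
exact: specialized_seed_mut sp1 eq1 kex mq me.
Qed.

Let specB := spec_relB t e Mq M.
Let specM := spec_relM _ _ divq div ct ce t0 e0 _ _ _ fq fe.

Let spec_e : spec t e.
Proof. exact: (spec_rel_scalar _ _ _ _ _ fq fe 1). Qed.

Let spec_eV : spec t^-1 e^-1.
Proof. exact: (spec_rel_scalar _ _ _ _ _ fq fe (-1)). Qed.

Let spec_inv j : spec (Mq (evec j))^-1 (M (evec j))^-1.
Proof. by rewrite (frameV fq) (frameV fe); exact: spec_rel_mono. Qed.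

Lemma spec_image_cluster_alg (inv : {set 'I_N}) y :
  spec_image t Mq e M (cluster_alg 0 t ex Mq B0 inv) y <-> cluster_alg l e ex M B0 inv y.
Proof.
split=> [[x gx sxy]|gy].
  suff [y' gy' sxy'] : exists2 y', cluster_alg l e ex M B0 inv y' & spec x y'.
    by rewrite (spec_rel_unique _ _ lev0 _ _ _ fq _ _ _ sxy sxy').
  apply: (gx (fun x' => exists2 y', cluster_alg l e ex M B0 inv y' & spec x' y')) => [|x1 x2 [y1 g1 s1] [y2 g2 s2]|x1 x2 [y1 g1 s1] [y2 g2 s2]| | |x1].
  - by exists 1; [exact: alg_gen1 | exact: (spec_rel1 _ _ _ _ _ fq fe)].
  - by exists (y1 - y2); [exact: alg_genB | exact: specB].
  - by exists (y1 * y2); [exact: alg_genM | exact: specM].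
  - by exists e; [exact: alg_gen_scalar|].
  - by exists e^-1; [exact: alg_gen_scalarV|].
  - case=> [[Mq' [B' [i [eq' ->]]]]|[j [jinv ->]]].
      have [M' e' [L' [_ _ _ sp]]] := specialize_mut_equiv _ _ eq'.
      by exists (M' (evec i)) => //; apply: alg_gen_mem; left; exists M', B', i.
    by exists (M (evec j))^-1 => //; apply: alg_gen_mem; right; exists j.
apply: (gy (spec_image t Mq e M (cluster_alg 0 t ex Mq B0 inv))) => [|y1 y2 [x1 g1 s1] [x2 g2 s2]|y1 y2 [x1 g1 s1] [x2 g2 s2]| | |y1].
- by exists 1; [exact: alg_gen1 | exact: (spec_rel1 _ _ _ _ _ fq fe)].
- by exists (x1 - x2); [exact: alg_genB | exact: specB].
- by exists (x1 * x2); [exact: alg_genM | exact: specM].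
- by exists t; [exact: alg_gen_scalar|].
- by exists t^-1; [exact: alg_gen_scalarV|].
- case=> [[M' [B' [i [e' ->]]]]|[j [jinv ->]]].
    have [Mq' eq' [L' [_ _ _ sp]]] := lift_mut_equiv _ _ e'.
    exists (Mq' (evec i)); last exact: sp.
    by apply: alg_gen_mem; left; exists Mq', B', i.
  exists (Mq (evec j))^-1; last exact: spec_inv.
  by apply: alg_gen_mem; right; exists j.
Qed.

End ClusterAlgebras.

Theorem theorem5p7
  (N l : nat) (ex inv : {set 'I_N}) (d : 'I_N -> int) (Bt Lam : 'M[int]_N)
  (* root of unity side: division algebra F over Q(eps^{1/2}), eps^{1/2} = e *)
  (F : unitRingType) (e : F) (M : 'rV[int]_N -> F) (LM : 'M[int]_N)
  (* quantum side: division algebra Fq over Q(q^{1/2}), q^{1/2} = t *)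
  (Fq : unitRingType) (t : Fq) (Mq : 'rV[int]_N -> Fq) :
  (0 < l)%N ->
  division_ring F -> char0 F -> central e -> l.-primitive_root e ->
  (* (M, Btilde) is a root of unity seed, Lambda_M = LM mod l *)
  toric_frame l e M LM -> compatible l ex d LM Bt ->
  (* strictness w.r.t. Lam *)
  (forall i j, Lam i j = - Lam j i) ->
  (forall i j, congz l (Lam i j) (LM i j)) ->
  compatible 0 ex d Lam Bt ->
  (* associated quantum seed: Mq(f) = X^f, Lambda_{Mq} = Lam *)
  division_ring Fq -> central t -> transcendental t ->
  toric_frame 0 t Mq Lam ->
  (* inv is contained in [1,N] \ ex *)
  [disjoint inv & ex] ->
  exists phi : F -> F,
    alg_iso e (spec_image t Mq e M (cluster_alg 0 t ex Mq Bt inv))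
              (cluster_alg l e ex M Bt inv) phi.
Proof.
move=> l0 div _ ce pe tM _ skL cong comp divq ct trt tq _.
have sLB := compatible_iseed _ _ _ _ _ skL comp.
have orde := primitive_order _ _ _ div pe.
(* Strictness enters here: the powers of e given by LM and by Lam agree, so Lam replaces LM. *)
have te : toric_frame l e M Lam.
  apply: (toric_frame_congr _ div (primitive_root_neq0 _ _ _ pe) _ orde _ LM) => //.
    exact: iseed_alt sLB.
  by move=> i j; apply/esym/orde.
have imP := spec_image_cluster_alg _ _ _ _ _ _ _ _ _ divq div ct ce trt pe tq te sLB inv.
exists id; split=> //.
- by move=> x /imP.
- by move=> y /imP sy; exists y.
Qed.
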